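(* Let $r=p^\nu$ be a prime power ($p$ prime, $\nu\ge 1$), let $G=(\mathbb{Z}_p)^\nu$, and let $G$ act freely and transitively by permutations on a set $\Pi$ of $r$ ''plates''. Let $\mathcal{C}_r$ be the natural configuration space (defined in the context), with the induced $G$-action $\sigma(x,\alpha)=(x,\sigma\circ\alpha)$. Let $(A^j_i)_{i\in\Pi}^{j\in[r]}$ be a matrix of subsets $A^j_i\subseteq\mathcal{C}_r$ such that: (a) every $A^j_i$ is closed in $\mathcal{C}_r$; (b) for every $j\in[r]$, $\bigcup_{i\in\Pi}A^j_i=\mathcal{C}_r$; (c) for every $\sigma\in G$, every $i\in\Pi$, $j\in[r]$ and $(x,\alpha)\in\mathcal{C}_r$: $(x,\alpha)\in A^j_i \iff \sigma(x,\alpha)\in A^j_{\sigma(i)}$. Then there exist a point $(x,\alpha)\in\mathcal{C}_r$ and a bijection $\sigma:[r]\to\Pi$ such that $(x,\alpha)\in\bigcap_{j=1}^r A^j_{\sigma(j)}$.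
   Context: A proper cut of $[0,1]$ with tile number $k$ ($1\le k\le r$) is a sequence $x=(0=x_0<x_1<\dots<x_{k-1}<x_k=1)$; its tiles are $I_i(x)=[x_{i-1},x_i]$, $i\in[k]$. The natural configuration space $\mathcal{C}_r$ is the set of all pairs $(x,\alpha)$ where $x$ is a proper cut with some tile number $k\le r$ and $\alpha:[k]\to\Pi$ is an injective map (tile $I_i(x)$ is placed in plate $\alpha(i)$; some plates may be empty). A proper cut is identified with the finite set $\{x_0,\dots,x_k\}\subseteq[0,1]$. $\mathcal{C}_r$ carries the topology in which a sequence $(x^n,\alpha_n)$ converges to $(x,\alpha)$ (with $x$ of tile number $k$) if and only if: (1) $\{x^n_0,\dots,x^n_{k_n}\}\to\{x_0,\dots,x_k\}$ in the Hausdorff metric on finite subsets of $[0,1]$, and (2) there is $n_0$ such that for all $n\ge n_0$ and all $i\in[k]$, the tile of $x^n$ containing the midpoint of $I_i(x)$ is assigned by $\alpha_n$ to the plate $\alpha(i)$ (the values of $\alpha_n$ on the remaining tiles, whose lengths tend to $0$, are irrelevant). The interpretation is that $(x,\alpha)\in A^j_i$ means that player $j$, given the cut $x$ and allocation $\alpha$, prefers the contents of plate $i$. *)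

(* Defs.v *)
From HB Require Import structures.
From mathcomp Require Import all_boot all_order all_algebra all_fingroup.
From mathcomp Require Import all_classical all_reals.
From mathcomp Require Import topology normedtype sequences.
From mathcomp Require Import lra.

Set Implicit Arguments.
Unset Strict Implicit.
Unset Printing Implicit Defensive.

Import Order.TTheory GRing.Theory Num.Theory.
Import numFieldNormedType.Exports.

Local Open Scope classical_set_scope.
Local Open Scope ring_scope.

(* The tile number is positive automatically, because 0 != 1. *)
Record config (R : realType) (r : nat) (Pi : finType) := Config {
  tiles : nat;
  tiles_le : (tiles <= r)%N;
  cut : 'I_tiles.+1 -> R;
  cut_first : cut ord0 = 0;
  cut_last : cut ord_max = 1;
  cut_lt : forall i j : 'I_tiles.+1, (i < j)%N -> cut i < cut j;
  plate : 'I_tiles -> Pi;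
  plate_inj : injective plate
}.

Arguments cut {R r Pi} c i.
Arguments plate {R r Pi} c i.

HB.instance Definition _ (R : realType) r Pi := gen_eqMixin (config R r Pi).
HB.instance Definition _ (R : realType) r Pi := gen_choiceMixin (config R r Pi).

Definition cutset (R : realType) r Pi (c : config R r Pi) : set R :=
  range (cut c).

Section Tiles.
Context (R : realType) (r : nat) (Pi : finType) (c : config R r Pi).
Implicit Type i : 'I_(tiles c).

(* Tiles are numbered from 0, so tile i runs from x_i to x_(i+1). *)
Definition tile_left i : R := cut c (widen_ord (leqnSn _) i).
Definition tile_right i : R := cut c (lift ord0 i).
Definition tile i : set R := [set t | tile_left i <= t <= tile_right i].
Definition tile_mid i : R := (tile_left i + tile_right i) / 2.

End Tiles.

Definition set_dist (R : realType) (t : R) (B : set R) : R :=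
  inf [set `|t - b| | b in B].

(* The Hausdorff distance; sup and inf are real-valued, so this is meaningful
   only for nonempty bounded sets, such as the sets [cutset c]. *)
Definition hausdorff_dist (R : realType) (A B : set R) : R :=
  Num.max (sup [set set_dist a B | a in A]) (sup [set set_dist b A | b in B]).

Definition config_cvg (R : realType) r Pi
    (u : nat -> config R r Pi) (c : config R r Pi) : Prop :=
  hausdorff_dist (cutset (u n)) (cutset c) @[n --> \oo] --> (0 : R) /\
  \forall n \near \oo, forall i : 'I_(tiles c),
    exists2 j : 'I_(tiles (u n)),
      tile j (tile_mid i) & plate (u n) j = plate c i.

(* The sequential topology of [config_cvg]. Its convergent sequences are
   exactly those of [config_cvg] (lemma [config_cvgP]), and its closed sets are
   the sequentially closed ones (lemma [config_closedP]). *)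
Definition config_open (R : realType) r Pi (U : set (config R r Pi)) : Prop :=
  forall u c, config_cvg u c -> U c -> \forall n \near \oo, U (u n).

Section ConfigTopology.
Context (R : realType) (r : nat) (Pi : finType).
Local Notation T := (config R r Pi).

Let config_openT : config_open [set: T].
Proof. by move=> u c _ _; exact: nearW. Qed.

Let config_openI : setI_closed (@config_open R r Pi).
Proof.
by move=> A B oA oB u c uc [Ac Bc]; near=> n; split; near: n;
  [exact: oA uc Ac | exact: oB uc Bc].
Unshelve. all: by end_near. Qed.

Let config_open_bigU (I : Type) (f : I -> set T) :
  (forall i, config_open (f i)) -> config_open (\bigcup_i f i).
Proof.
move=> of_ u c uc [i _ fic]; near=> n; exists i => //.
by near: n; exact: of_ uc fic.
Unshelve. all: by end_near. Qed.

HB.instance Definition _ := @isOpenTopological.Build T (@config_open R r Pi)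
  config_openT config_openI config_open_bigU.

End ConfigTopology.

Lemma config_openE (R : realType) r Pi :
  open = @config_open R r Pi :> set (set (config R r Pi)).
Proof.
apply/funext => A; apply/propext; rewrite openE; split.
  move=> oA u c uc /oA; rewrite /interior => -[B [oB Bc BA]].
  by near=> n; apply: BA; near: n; exact: oB uc Bc.
by move=> oA c Ac; exists A; split.
Unshelve. all: by end_near. Qed.

Section ConfigTopologyTheory.
Context (R : realType) (r : nat) (Pi : finType).
Local Notation T := (config R r Pi).
Implicit Types (c d : T) (A B C : set R) (e : R).

Definition hausdorff_near e A B : Prop :=
  (forall a, A a -> exists2 b, B b & `|a - b| < e) /\
  (forall b, B b -> exists2 a, A a & `|b - a| < e).

Lemma cut_le c (i j : 'I_(tiles c).+1) : (i <= j)%N -> cut c i <= cut c j.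
Proof.
rewrite leq_eqVlt => /orP[/eqP/val_inj -> //|ij].
exact/ltW/cut_lt.
Qed.

Lemma cutset01 c a : cutset c a -> 0 <= a <= 1.
Proof.
move=> [i _ <-]; rewrite -[X in X <= _](cut_first c) -(cut_last c).
by rewrite !cut_le //= -ltnS.
Qed.

Lemma cutset_neq0 c : cutset c !=set0.
Proof. by exists 0; exists ord0 => //; exact: cut_first. Qed.

Lemma set_dist_le1 c a : 0 <= a <= 1 -> set_dist a (cutset c) <= 1.
Proof.
move=> a01; have [b cb] := cutset_neq0 c.
have /andP[b0 b1] := cutset01 cb; case/andP: a01 => a0 a1.
apply: (@le_trans _ _ `|a - b|); last by rewrite ler_norml; lra.
by apply: ge_inf; [exists 0 => _ [x _ <-]|exists b].
Qed.

Lemma hausdorff_lt_near c d e :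
  hausdorff_dist (cutset c) (cutset d) < e ->
  hausdorff_near e (cutset c) (cutset d).
Proof.
have aux (c1 c2 : T) :
    sup [set set_dist a (cutset c2) | a in cutset c1] < e ->
    forall a, cutset c1 a -> exists2 b, cutset c2 b & `|a - b| < e.
  move=> he a ca.
  have {}he : set_dist a (cutset c2) < e.
    apply: le_lt_trans he; apply: ub_le_sup; last by exists a.
    by exists 1 => _ [x /cutset01 cx <-]; exact: set_dist_le1.
  have [|_ [b cb <-] ab] := inf_lt _ he; last by exists b.
  by have [b cb] := cutset_neq0 c2; exists `|a - b|; exists b.
by rewrite /hausdorff_dist gt_max => /andP[cd dc]; split; exact: aux.
Qed.

Lemma hausdorff_near_le c d e :
  hausdorff_near e (cutset c) (cutset d) ->
  hausdorff_dist (cutset c) (cutset d) <= e.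
Proof.
have aux (c1 c2 : T) :
    (forall a, cutset c1 a -> exists2 b, cutset c2 b & `|a - b| < e) ->
    sup [set set_dist a (cutset c2) | a in cutset c1] <= e.
  move=> h; apply: ge_sup.
    by have [b cb] := cutset_neq0 c1; exists (set_dist b (cutset c2)); exists b.
  move=> _ [a ca <-]; have [b cb ab] := h a ca.
  apply: le_trans (ltW ab); apply: ge_inf; last by exists b.
  by exists 0 => _ [x _ <-].
by move=> [cd dc]; rewrite /hausdorff_dist ge_max !aux.
Qed.

Lemma hausdorff_nearC e A B : hausdorff_near e A B -> hausdorff_near e B A.
Proof. by case. Qed.

Lemma hausdorff_near_trans e1 e2 A B C :
  hausdorff_near e1 A B -> hausdorff_near e2 B C -> hausdorff_near (e1 + e2) A C.
Proof.
move=> [AB BA] [BC CB]; split.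
  move=> a /AB[b /BC[x Cx bx] ab]; exists x => //.
  by apply: le_lt_trans (ler_distD b _ _) _; rewrite ltrD.
move=> a /CB[b /BA[x Ax bx] ab]; exists x => //.
by apply: le_lt_trans (ler_distD b _ _) _; rewrite [e1 + _]addrC ltrD.
Qed.

Lemma cut_left_or_right c (i : 'I_(tiles c)) a :
  cutset c a -> a <= tile_left i \/ tile_right i <= a.
Proof.
move=> [j _ <-]; have [ji|ij] := leqP j i; [left|right]; apply: cut_le => //=.
Qed.

Lemma tile_lt c (i : 'I_(tiles c)) : tile_left i < tile_right i.
Proof. by apply: cut_lt; rewrite /= /bump leq0n. Qed.

Definition config_ball c e : set T := [set d |
  hausdorff_dist (cutset c) (cutset d) < e /\
  forall i : 'I_(tiles c),
    exists2 j : 'I_(tiles d), tile j (tile_mid i) & plate d j = plate c i].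

Definition tiles_wide c e := forall i : 'I_(tiles c),
  2 * e <= tile_right i - tile_left i.

Lemma tiles_wideW c e1 e2 : e1 <= e2 -> tiles_wide c e2 -> tiles_wide c e1.
Proof. by move=> e12 w i; apply: le_trans (w i); lra. Qed.

Lemma tiles_wide_ex c : exists2 e : R, 0 < e & tiles_wide c e.
Proof.
exists (\big[Num.min/1]_(i < tiles c) ((tile_right i - tile_left i) / 2)).
  by apply/bigmin_gtP; split=> // i _; have := tile_lt i; lra.
by move=> i; rewrite -ler_pdivlMl // mulrC; exact: bigmin_le.
Qed.

Lemma config_ball_open c e : tiles_wide c e -> config_open (config_ball c e).
Proof.
move=> wc u d [ud_dist ud_plate] [cd_dist cd_plate].
have [d0 d00 wd] := tiles_wide_ex d.
have dist_near (x : R) : 0 < x ->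
    \forall n \near \oo, hausdorff_near x (cutset d) (cutset (u n)).
  move=> x0; have /cvgrPdist_lt /(_ x x0) := ud_dist.
  apply: filterS => n; rewrite sub0r normrN => h.
  apply/hausdorff_nearC/hausdorff_lt_near.
  exact: le_lt_trans (ler_norm _) h.
have dist_u : \forall n \near \oo,
    hausdorff_dist (cutset c) (cutset (u n)) < e.
  set h := hausdorff_dist _ _ in cd_dist.
  have x0 : 0 < (e - h) / 3 by lra.
  apply: filterS (dist_near _ x0) => n dn.
  have cn : hausdorff_near (h + (e - h) / 3) (cutset c) (cutset d).
    by apply: hausdorff_lt_near; rewrite -/h; lra.
  apply: le_lt_trans (hausdorff_near_le (hausdorff_near_trans cn dn)) _.
  lra.
have plate_u : \forall n \near \oo, forall i : 'I_(tiles c),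
    exists2 j : 'I_(tiles (u n)), tile j (tile_mid i) & plate (u n) j = plate c i.
  apply: filter_forall => i.
  have [j /andP[lm mr] pj] := cd_plate i.
  have mid_notin b : cutset d b -> b <> tile_mid i.
    move=> db bm; have [_ /(_ b db) [a ca]] := hausdorff_lt_near cd_dist.
    rewrite bm /tile_mid => am; have := wc i.
    case: (cut_left_or_right i ca) => ?; move: am; rewrite ltr_norml; lra.
  have lm' : tile_left j < tile_mid i.
    rewrite lt_neqAle lm andbT; apply/eqP; apply: mid_notin.
    by exists (widen_ord (leqnSn _) j).
  have mr' : tile_mid i < tile_right j.
    rewrite lt_neqAle mr andbT eq_sym; apply/eqP; apply: mid_notin.
    by exists (lift ord0 j).
  pose x := Num.min (tile_mid i - tile_left j) (Num.min (tile_right j - tile_mid i)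
    ((tile_right j - tile_left j) / 2)).
  have x0 : 0 < x by rewrite /x !lt_min; apply/and3P; split; lra.
  have : [/\ x <= tile_mid i - tile_left j, x <= tile_right j - tile_mid i &
      x <= (tile_right j - tile_left j) / 2].
    by rewrite /x; split; rewrite !ge_min lexx ?orbT.
  move=> [x1 x2 x3].
  near=> n.
  have [_ dn] : hausdorff_near x (cutset d) (cutset (u n)).
    by near: n; exact: dist_near.
  have [j' /andP[l' r'] pj'] : exists2 j' : 'I_(tiles (u n)),
      tile j' (tile_mid j) & plate (u n) j' = plate d j.
    near: n; apply: filterS ud_plate => n; exact.
  exists j'; last by rewrite pj' pj.
  have out z : cutset (u n) z ->
      (z < tile_mid i /\ z < tile_mid j) \/ (tile_mid i < z /\ tile_mid j < z).
    move=> /dn[b db]; rewrite ltr_norml /(tile_mid j) => zb.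
    by case: (cut_left_or_right j db) => ?; [left|right]; split; lra.
  have ul : cutset (u n) (tile_left j') by exists (widen_ord (leqnSn _) j').
  have ur : cutset (u n) (tile_right j') by exists (lift ord0 j').
  by apply/andP; split; [case: (out _ ul)|case: (out _ ur)] => -[]; lra.
near=> n; split; near: n; [exact: dist_u|exact: plate_u].
Unshelve. all: by end_near. Qed.

Lemma config_ball_center c e : 0 < e -> config_ball c e c.
Proof.
move=> e0; split.
  apply: (@le_lt_trans _ _ (e / 2)); last lra.
  by apply: hausdorff_near_le; split=> a ca; exists a => //;
    rewrite subrr normr0; lra.
by move=> i; exists i => //; have := tile_lt i; rewrite /tile /tile_mid /=; lra.
Qed.

Lemma config_cvgP (u : nat -> T) c : u n @[n --> \oo] --> c <-> config_cvg u c.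
Proof.
split=> [uc|uc A [B [oB Bc BA]]]; last first.
  by apply: filterS BA _; exact: oB uc Bc.
have ball_u e : 0 < e -> tiles_wide c e -> \forall n \near \oo, config_ball c e (u n).
  move=> e0 we; apply: (uc (config_ball c e)).
  exists (config_ball c e); split => //; first exact: config_ball_open.
  exact: config_ball_center.
have [e0 e00 we0] := tiles_wide_ex c.
split; last by apply: filterS (ball_u _ e00 we0) => n [].
apply/cvgrPdist_le => e1 e10.
have e2w : tiles_wide c (Num.min e0 e1).
  by apply: tiles_wideW we0; rewrite ge_min lexx.
have e20 : 0 < Num.min e0 e1 by rewrite lt_min e00.
apply: filterS (ball_u _ e20 e2w) => n [cn _].
rewrite sub0r normrN ger0_norm.
  apply/hausdorff_near_le/hausdorff_nearC/hausdorff_lt_near.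
  by apply: lt_le_trans cn _; rewrite ge_min lexx orbT.
rewrite /hausdorff_dist le_max; apply/orP; left.
have [a ua] := cutset_neq0 (u n).
apply: (@le_trans _ _ (set_dist a (cutset c))).
  apply: lb_le_inf => [|_ [b _ <-] //].
  by have [b cb] := cutset_neq0 c; exists `|a - b|; exists b.
apply: ub_le_sup; last by exists a.
by exists 1 => _ [x /cutset01 ux <-]; exact: set_dist_le1.
Qed.

Lemma config_closedP (A : set T) : closed A <->
  forall u c, (forall n, A (u n)) -> config_cvg u c -> A c.
Proof.
rewrite -openC config_openE; split=> [oA u c Au uc|cA u c uc nAc].
  apply: contrapT => nAc; have [N _ /(_ N (leqnn N))] := oA u c uc nAc.
  by apply; exact: Au.
apply: contrapT => nU; apply: nAc.
have /choice[f fP] : forall N, exists n, (N <= n)%N /\ A (u n).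
  move=> N; apply: contrapT => h; apply: nU; exists N => // n /= Nn An.
  by apply: h; exists n.
apply: (cA (u \o f)); first by move=> n; case: (fP n).
have f_cvg : f n @[n --> \oo] --> \oo.
  move=> B [N _ NB]; exists N => // n /= Nn; apply: NB => /=.
  by case: (fP n) => /(leq_trans Nn).
case: uc => ud up; split; first exact: (cvg_comp _ _ f_cvg ud).
exact: f_cvg up.
Qed.

End ConfigTopologyTheory.

(* [(x, alpha) |-> (x, s \o alpha)], for a group acting on the plates *)
Definition config_act (gT : finGroupType) (R : realType) r (Pi : finType)
    (to : {action gT &-> Pi}) (c : config R r Pi) (s : gT) : config R r Pi :=
  Config (tiles_le c) (cut_first c) (cut_last c) (@cut_lt _ _ _ c)
    (inj_comp (act_inj to s) (@plate_inj _ _ _ c)).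

(* Main.v *)
Require Import Defs.
From mathcomp Require Import all_boot all_order all_algebra all_fingroup.
From mathcomp Require Import all_classical all_reals.
From mathcomp Require Import topology normedtype sequences.
From mathcomp Require Import zify ring lra.

(**
A point of C_r is an injective word on Pi (the plates of the tiles, from left to
right) with positive weights (their lengths), so C_r is the realization of the
complex of injective words. Subdivide it finely, and label the vertex of the
last barycentric subdivision that comes from a j-dimensional simplex by a plate
preferred by player j. As G acts freely, the labels can be chosen equivariantly.
A small simplex with pairwise distinct labels yields r nearby configurations, in
which the players prefer distinct plates, and compactness concludes.

If no simplex has distinct labels, the labelling pulls alternating cochains on Pi
back to cochains on injective words, commutes with coboundaries and with G, and
kills the top cochain e. Take a field K of characteristic p with elements X^i
linearly independent over F_p, and u = sum_i X^i (g_i - 1) in K[G], with g_i the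
standard basis of G; then u^p = 0. Alternating cochains of intermediate degree
live on orbits G/H with H proper, over which functions are free over K[u]/(u^p).
Hence the zigzag from e down to degree 0 through coboundaries and, alternately,
u and u^(p-1) ends with a nonzero constant. Since injective words are exact
below the top degree, the same zigzag for the pulled back cochains, starting
from 0, shows that this constant is 0.
*)

Set Implicit Arguments.
Unset Strict Implicit.
Unset Printing Implicit Defensive.

Import Order.TTheory GRing.Theory Num.Theory.
Import numFieldNormedType.Exports.

Local Open Scope ring_scope.

(** * Coboundaries of cochains on words *)

Section Coboundary.
Variables (K : comNzRingType).

(* The alternating sum of f over the words obtained from w by deleting a letter *)
Fixpoint cobd (X : Type) (f : seq X -> K) (w : seq X) : K :=
  if w is a :: v then f v - cobd (fun s => f (a :: s)) v else 0.

Lemma cobd_ext (X : Type) (f g : seq X -> K) w :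
  (forall s1 a s2, w = s1 ++ a :: s2 -> f (s1 ++ s2) = g (s1 ++ s2)) ->
  cobd f w = cobd g w.
Proof.
elim: w f g => //= a w IH f g fg; rewrite (fg [::] a w (erefl _)); congr (_ - _).
by apply: IH => s1 b s2 wE; apply: (fg (a :: s1) b s2); rewrite wE.
Qed.

Lemma eq_cobd (X : Type) (f g : seq X -> K) : f =1 g -> cobd f =1 cobd g.
Proof. by move=> fg w; apply: cobd_ext => *; apply: fg. Qed.

Lemma cobdD (X : Type) (f g : seq X -> K) w :
  cobd (fun s => f s + g s) w = cobd f w + cobd g w.
Proof. by elim: w f g => /= [|a w IH] f g; rewrite ?addr0 // IH; ring. Qed.

Lemma cobdZ (X : Type) k (f : seq X -> K) w :
  cobd (fun s => k * f s) w = k * cobd f w.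
Proof. by elim: w f => /= [|a w IH] f; rewrite ?mulr0 // IH; ring. Qed.

Lemma cobdN (X : Type) (f : seq X -> K) w :
  cobd (fun s => - f s) w = - cobd f w.
Proof. by elim: w f => /= [|a w IH] f; rewrite ?oppr0 // IH; ring. Qed.

Lemma cobdB (X : Type) (f g : seq X -> K) w :
  cobd (fun s => f s - g s) w = cobd f w - cobd g w.
Proof. by rewrite cobdD cobdN. Qed.

Lemma cobd0 (X : Type) w : cobd (fun _ : seq X => 0) w = 0.
Proof. by elim: w => //= a w ->; rewrite subr0. Qed.

Lemma cobd_sum (X : Type) (I : finType) (F : I -> seq X -> K) w :
  cobd (fun s => \sum_i F i s) w = \sum_i cobd (F i) w.
Proof.
elim: w F => /= [|a w IH] F; first by rewrite big1.
by rewrite IH sumrB.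
Qed.

Lemma cobd_cobd (X : Type) (f : seq X -> K) w : cobd (cobd f) w = 0.
Proof.
by elim: w f => //= a w IH f; rewrite cobdB IH subr0 subrr.
Qed.

Lemma cobd_map (X Y : Type) (h : X -> Y) (f : seq Y -> K) w :
  cobd f (map h w) = cobd (fun s => f (map h s)) w.
Proof. by elim: w f => //= a w IH f; rewrite IH. Qed.

Lemma cobd_cat (X : Type) (f : seq X -> K) s1 s2 :
  cobd f (s1 ++ s2) =
  cobd (fun s => f (s ++ s2)) s1 + (-1) ^+ size s1 * cobd (fun s => f (s1 ++ s)) s2.
Proof.
elim: s1 f => /= [|a s1 IH] f; first by rewrite add0r mul1r.
by rewrite IH exprS; ring.
Qed.

Lemma cobd_neq0 (X : Type) (f : seq X -> K) w : cobd f w != 0 ->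
  exists s1 a s2, w = s1 ++ a :: s2 /\ f (s1 ++ s2) != 0.
Proof.
elim: w f => /= [|a w IH] f; first by rewrite eqxx.
have [fw|fw _] := eqVneq (f w) 0; last by exists [::], a, w.
rewrite fw sub0r oppr_eq0 => /IH[s1 [b [s2 [-> h]]]].
by exists (a :: s1), b, s2.
Qed.

(** * Subdivision operators *)

(* The signed sum of F over the flags of faces of t, largest face first, a face s
   giving the vertex [beta s]; barycentric subdivision if beta is the barycenter. *)
Fixpoint subdiv_rec (X Y : Type) (beta : seq X -> Y) n (F : seq Y -> K) (t : seq X) : K :=
  if n is m.+1 then cobd (subdiv_rec beta m (fun s => F (beta t :: s))) t else F [::].

Definition subdiv (X Y : Type) (beta : seq X -> Y) F t :=
  subdiv_rec beta (size t) F t.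

Lemma size_del (X : Type) (s1 : seq X) a s2 n :
  size (s1 ++ a :: s2) = n.+1 -> size (s1 ++ s2) = n.
Proof. by rewrite !size_cat /= addnS => -[]. Qed.

Section Subdiv.
Variables (X Y : Type) (beta : seq X -> Y).

Lemma subdivE F t : (0 < size t)%N ->
  subdiv beta F t = cobd (subdiv beta (fun s => F (beta t :: s))) t.
Proof.
rewrite /subdiv; case E: (size t) => [|n] //= _.
by apply: cobd_ext => s1 a s2 w; rewrite w in E; rewrite (size_del E).
Qed.

Lemma subdiv_ind (P : seq X -> Prop) :
  P [::] ->
  (forall t, (0 < size t)%N ->
     (forall s1 a s2, t = s1 ++ a :: s2 -> P (s1 ++ s2)) -> P t) ->
  forall t, P t.
Proof.
move=> P0 PS t; elim: {t}(size t) {-2}t (erefl (size t)) => [|n IH] t st.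
  by rewrite (size0nil st).
apply: PS => [|s1 a s2 tE]; first by rewrite st.
by apply: IH; rewrite tE in st; apply: size_del st.
Qed.

Lemma subdivD F G t : subdiv beta (fun s => F s + G s) t = subdiv beta F t + subdiv beta G t.
Proof.
elim/subdiv_ind: t F G => // t t0 IH F G; rewrite !subdivE // -cobdD.
by apply: cobd_ext => s1 a s2 /IH ->.
Qed.

Lemma subdivZ k F t : subdiv beta (fun s => k * F s) t = k * subdiv beta F t.
Proof.
elim/subdiv_ind: t F => // t t0 IH F; rewrite !subdivE // -cobdZ.
by apply: cobd_ext => s1 a s2 /IH ->.
Qed.

Lemma subdivB F G t : subdiv beta (fun s => F s - G s) t = subdiv beta F t - subdiv beta G t.
Proof.
rewrite -mulN1r -subdivZ -subdivD.
by elim/subdiv_ind: t F G => /= [|t t0 IH] F G;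
  [rewrite /subdiv /= mulN1r|rewrite !subdivE //; apply: cobd_ext => s1 a s2 /IH ->].
Qed.

(** The subdivision of [t] is the cone from [beta t] over the subdivided boundary. On words starting
    with [beta t], [cobd F] is [F] minus a coboundary; by induction on faces the latter remains a
    coboundary after subdivision, and [cobd_cobd] kills it. *)
Lemma cobd_subdiv F t : cobd (subdiv beta F) t = subdiv beta (cobd F) t.
Proof.
elim/subdiv_ind: t F => // t t0 IH F.
rewrite [RHS]subdivE //=.
rewrite (@cobd_ext _ (subdiv beta (fun s => F s - cobd (fun s0 => F (beta t :: s0)) s))
  (fun w => subdiv beta F w - cobd (subdiv beta (fun s => F (beta t :: s))) w)).
  by rewrite cobdB cobd_cobd subr0.
by move=> s1 a s2 tE; rewrite subdivB (IH s1 a s2 tE).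
Qed.

Inductive flag : seq X -> seq Y -> Prop :=
| flag_nil : flag [::] [::]
| flag_cons s1 a s2 l : flag (s1 ++ s2) l ->
    flag (s1 ++ a :: s2) (beta (s1 ++ a :: s2) :: l).

Lemma subdiv_neq0 F t : subdiv beta F t != 0 -> exists2 l, flag t l & F l != 0.
Proof.
elim/subdiv_ind: t F => [|t t0 IH] F.
  by exists [::] => //; constructor.
rewrite subdivE // => /cobd_neq0[s1 [a [s2 [tE]]]].
move=> /(IH _ _ _ tE)[l fl Fl]; exists (beta t :: l) => //.
by rewrite tE; constructor.
Qed.

End Subdiv.

(* With phi and psi the identity this is locality in beta, with translations it
   is equivariance. *)
Lemma subdiv_nat (X X' Y Y' : Type) (beta : seq X -> Y) (beta' : seq X' -> Y')
    (phi : X -> X') (P : pred X) (F : seq Y -> K) (F' : seq Y' -> K) (psi : Y -> Y')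
    (Q : pred Y) (t : seq X) :
  (forall s, (0 < size s)%N -> all P s -> Q (beta s) /\ beta' (map phi s) = psi (beta s)) ->
  (forall s, all Q s -> F' (map psi s) = F s) ->
  all P t ->
  subdiv beta' F' (map phi t) = subdiv beta F t.
Proof.
move=> hb; elim/subdiv_ind: t F F' => [|t t0 IH] F F' hF Pt.
  exact: (hF [::]).
rewrite !subdivE ?size_map // cobd_map.
have [Qt bt] := hb t t0 Pt.
apply: cobd_ext => s1 a s2 tE; apply: (IH _ _ _ tE).
  by move=> s Qs; rewrite bt; apply: (hF (beta t :: s)); rewrite /= Qt.
by move: Pt; rewrite tE !all_cat /= => /and3P[-> _ ->].
Qed.

End Coboundary.

(** * Injective words *)

Definition injword (X : finType) (D : {set X}) k (w : seq X) :=
  [&& uniq w, all [in D] w & size w == k].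

Lemma injword_del (X : finType) (D : {set X}) k s1 a s2 :
  injword D k.+1 (s1 ++ a :: s2) -> injword D k (s1 ++ s2).
Proof.
rewrite /injword !all_cat /= -cat1s uniq_catCA /= => /and3P[/andP[_ ->] /and3P[-> _ ->]] /=.
by rewrite !size_cat /= addnS.
Qed.

Lemma index_del (X : eqType) (z : X) s1 a s2 : uniq (s1 ++ a :: s2) ->
  z \in s1 ++ s2 ->
  (z \in s1 ++ a :: s2) && (index z (s1 ++ s2) <= index z (s1 ++ a :: s2))%N.
Proof.
rewrite -cat1s uniq_catCA /= => /andP[an _] zin; rewrite !mem_cat inE orbCA -mem_cat zin orbT /=.
rewrite !index_cat; case: ifP => // zs1 /=.
have: a != z by apply: contraNneq an => ->.
by move=> /negbTE ->; rewrite leq_add2l.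
Qed.

Section Exactness.
Variables (K : comNzRingType) (X : finType).
Implicit Types (D : {set X}) (f c : seq X -> K).

(* Words are killed in the order: those avoiding z, then those containing z,
   by increasing position of z; the words with a given prefix before z form
   the complex of injective words on the remaining letters. *)
Lemma injword_exact D k f : (k < #|D|)%N ->
  (forall w, injword D k.+1 w -> cobd f w = 0) ->
  exists c, forall w, injword D k w -> f w = cobd c w.
Proof.
elim: {D}_.+1 {-2}D (ltnSn #|D|) k f => // n IH D Dn k f kD clf.
have /card_gt0P[z zD] : (0 < #|D|)%N by apply: leq_ltn_trans kD.
have vanish j : exists c, forall w, injword D k w -> (z \notin w) || (index z w <= j)%N ->
    f w = cobd c w.
  elim: j => [|j [c hc]].
    (* The cone with apex [z] treats the words avoiding [z]. The value 0 on words containing [z]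
       settles those starting with [z] too: only the deletion of [z] contributes, and it returns
       [f w]. *)
    exists (fun w => if z \in w then 0 else f (z :: w)) => w hw.
    have [zw|zw] /= := boolP (z \in w); last first.
      have hzw : injword D k.+1 (z :: w).
        by move: hw; rewrite /injword /= zw zD eqSS.
      have /= /eqP := clf _ hzw; rewrite subr_eq0 => /eqP -> _.
      apply: cobd_ext => s1 a s2 wE; case: ifP => // zin.
      suff : z \in w by rewrite (negbTE zw).
      by move: zin; rewrite wE !mem_cat inE orbCA => ->; rewrite orbT.
    case: w zw hw => // a v; rewrite inE /=; case: eqVneq => [<- _|az] //.
    move=> /and3P[/= /andP[zv _] _ _] _; rewrite (negbTE zv).
    rewrite (@cobd_ext _ _ _ (fun _ => 0)) ?cobd0 ?subr0 // => s1 b s2 _.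
    by rewrite mem_head.
  (* In words this short, [z] cannot stand beyond position [j]. *)
  have [kj|jk] := leqP k j.+1.
    exists c => w hw; have [zw|zw _] := boolP (z \in w); last by apply: hc; rewrite ?zw.
    move=> _; apply: hc => //=; rewrite zw /=.
    move: zw; rewrite -index_mem; case/and3P: hw => _ _ /eqP ->; lia.
  pose g w := f w - cobd c w.
  have clg w : injword D k.+1 w -> cobd g w = 0.
    by move=> hw; rewrite /g cobdB cobd_cobd clf // subr0.
  have g0 w : injword D k w -> (z \notin w) || (index z w <= j)%N -> g w = 0.
    by move=> hw hz; rewrite /g (hc w hw hz) subrr.
  (* Behind the prefix [u] and [z], the word [v] uses the remaining letters; there [g] is closed,
     and the induction on the alphabet applies. *)
  have /choice[cu hcu] : forall u, exists c, injword (D :\ z) j.+1 u ->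
      forall v, injword (D :\ z :\: [set x in u]) (k - j.+2)%N v -> g (u ++ z :: v) = cobd c v.
    move=> u; have [hu|hu] := boolP (injword (D :\ z) j.+1 u); last by exists (fun=> 0).
    have [uu au su] := and3P hu.
    have cu : #|[set x in u]| = j.+1 by rewrite cardsE (card_uniqP uu) (eqP su).
    have uD : [set x in u] \subset D :\ z.
      by apply/fintype.subsetP => x; rewrite inE => /(allP au).
    have cD : #|D| = (#|D :\ z :\: [set x in u]| + j.+2)%N.
      rewrite cardsD (finset.setIidPr uD) cu (cardsD1 z D) zD.
      have := subset_leq_card uD; rewrite cu; lia.
    have uin x : x \in u -> (x != z) && (x \in D).
      by move=> /(allP au); rewrite !inE.
    have zu : z \notin u by apply/negP => /uin; rewrite eqxx.
    have [|||c0 hc0] := IH (D :\ z :\: [set x in u]) _ (k - j.+2)%N (fun v => g (u ++ z :: v)).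
    - by move: Dn; rewrite ltnS cD; lia.
    - by move: kD; rewrite cD; lia.
    - move=> v hv; have [uv av sv] := and3P hv.
      have vin x : x \in v -> [&& x \notin u, x != z & x \in D].
        by move=> /(allP av); rewrite !inE.
      have zv : z \notin v by apply/negP => /vin; rewrite eqxx andbF.
      have nuv : ~~ has [in u] v by apply/hasPn => x /vin /and3P[].
      have hw : injword D k.+1 (u ++ z :: v).
        rewrite /injword cat_uniq uu /= uv zv negb_or zu /= nuv all_cat /= zD /=.
        rewrite size_cat /= (eqP su) (eqP sv).
        apply/andP; split; last by lia.
        apply/andP; split; first by apply/allP => x /uin /andP[].
        by apply/allP => x /vin /and3P[].
      (* Deleting a letter of [u] moves [z] forward and deleting [z] removes it; [g] vanishes on the
         results, so only the deletions in [v] remain. *)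
      have := clg _ hw; rewrite cobd_cat /= (@cobd_ext _ _ _ (fun _ => 0)); last first.
        move=> s1 a s2 uE; apply: g0.
          by move: hw; rewrite uE -!catA; apply: injword_del.
        move: zu (eqP su); rewrite uE !mem_cat inE !negb_or => /and3P[z1 _ z2].
        rewrite !index_cat mem_cat (negbTE z1) (negbTE z2) /= eqxx addn0 size_cat /= addnS.
        by rewrite size_cat => -[->].
      rewrite cobd0 add0r [g (u ++ v)]g0; last 2 first.
      - by apply: (@injword_del _ _ _ _ z).
      - by rewrite mem_cat (negbTE zu) zv.
      by rewrite sub0r mulrN => /eqP; rewrite oppr_eq0 mulrI_eq0 ?(eqP su); [move/eqP|exact: lreg_sign].
    - by exists c0 => _.
  (* The letters of [v] stand behind [j.+2] others, whence the sign. *)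
  pose c' w := if (z \in w) && (index z w == j.+1) then
    (-1) ^+ j * cu (take j.+1 w) (drop j.+2 w) else 0.
  have c'0 w : (z \notin w) || (index z w <= j)%N -> c' w = 0.
    rewrite /c'; case: (z \in w) => //= ij; case: eqVneq => // jE.
    by move: ij; rewrite jE ltnn.
  exists (fun w => c w + c' w) => w hw hz; rewrite cobdD.
  have [lij|] := boolP ((z \notin w) || (index z w <= j)%N).
    rewrite (hc w hw lij) (@cobd_ext _ _ c' (fun _ => 0)) ?cobd0 ?addr0 // => s1 a s2 wE.
    apply: c'0; have [zs /=|//] := boolP (z \in s1 ++ s2).
    have /and3P[uw _ _] := hw; rewrite wE in uw.
    have /andP[zw iw] := index_del uw zs; move: lij; rewrite wE zw /=; exact: leq_trans.
  rewrite negb_or negbK -ltnNge => /andP[zw jz]; rewrite zw /= in hz.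
  have {hz jz} iz : index z w = j.+1 by apply/eqP; rewrite eqn_leq hz.
  have [u [v [wE su]]] : exists u v, w = u ++ z :: v /\ size u = j.+1.
    exists (take j.+1 w), (drop j.+2 w); split.
      by rewrite -{1}(cat_take_drop j.+1 w) (drop_nth z) -?iz ?index_mem // nth_index.
    by rewrite size_takel // -iz index_size.
  have /and3P[uw aw sw] := hw; move: uw aw sw; rewrite wE all_cat size_cat su /= addnS.
  rewrite -cat1s uniq_catCA cat1s /= mem_cat negb_or => /andP[/andP[zu zv] uuv].
  move=> /and3P[au _ av] sw; have /and3P[uu nuv uv] : [&& uniq u, ~~ has [in u] v & uniq v].
    by rewrite -cat_uniq.
  have gw : g w = cobd (cu u) v.
    rewrite wE; apply: hcu.
      rewrite /injword uu su eqxx andbT /=; apply/allP => x xu.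
      by rewrite !inE (allP au) // andbT; apply: contraNneq zu => <-.
    rewrite /injword uv /=; apply/andP; split; last by lia.
    apply/allP => x xv; rewrite !inE (allP av) // andbT (hasPn nuv x xv) /=.
    by apply: contraNneq zv => <-.
  rewrite -wE; suff -> : cobd c' w = g w by rewrite /g; ring.
  rewrite gw.
  rewrite wE cobd_cat /= (@cobd_ext _ _ _ (fun _ => 0)); last first.
    move=> s1 a s2 uE; apply: c'0.
    move: zu su; rewrite uE !mem_cat inE !negb_or => /and3P[z1 _ z2].
    rewrite !index_cat mem_cat (negbTE z1) (negbTE z2) /= eqxx addn0 size_cat /= addnS.
    by rewrite size_cat => -[->].
  rewrite cobd0 add0r (c'0 (u ++ v)) ?mem_cat ?negb_or ?zu ?zv // sub0r su.
  rewrite (@cobd_ext _ _ _ (fun s => (-1) ^+ j * cu u s)).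
    by rewrite cobdZ mulrN mulrA -exprD addSn exprS mulN1r mulNr opprK exprD -expr2 sqrr_sign mul1r.
  move=> s1 a s2 _; rewrite /c' mem_cat mem_head orbT index_cat (negbTE zu) /= eqxx addn0 su eqxx /=.
  by rewrite take_cat su ltnn subnn take0 cats0 drop_cat su ltnNge leqnSn /= subSnn /= drop0.
have [c hc] := vanish k; exists c => w hw; apply: hc => //.
by case/and3P: hw => _ _ /eqP <-; rewrite index_size orbT.
Qed.
End Exactness.

(** * Translation operators in characteristic p *)

Section AdditiveOperators.
Variable V : zmodType.
Implicit Types (X Y u s : V -> V) (v : V).

Definition additive_op X := {morph X : a b / a + b}.

Lemma additive_op0 X : additive_op X -> X 0 = 0.
Proof. by move=> aX; apply: (addrI (X 0)); rewrite -aX !addr0. Qed.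

Lemma additive_op_sum X n (F : 'I_n -> V) :
  additive_op X -> X (\sum_i F i) = \sum_i X (F i).
Proof. by move=> aX; apply: big_morph => //; apply: additive_op0. Qed.

Lemma additive_opMn X v n : additive_op X -> X (v *+ n) = X v *+ n.
Proof.
by move=> aX; elim: n => [|n IH]; rewrite ?mulr0n ?additive_op0 // !mulrS aX IH.
Qed.

Lemma additive_opN X v : additive_op X -> X (- v) = - X v.
Proof.
by move=> aX; apply: (addrI (X v)); rewrite -aX !subrr additive_op0.
Qed.

Lemma additive_opB X v w : additive_op X -> X (v - w) = X v - X w.
Proof. by move=> aX; rewrite aX additive_opN. Qed.

Lemma additive_iter X n : additive_op X -> additive_op (iter n X).
Proof. by move=> aX; elim: n => // n IH a b /=; rewrite IH aX. Qed.

Lemma iter_opD X Y n v : additive_op X -> additive_op Y ->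
  (forall v, X (Y v) = Y (X v)) ->
  iter n (fun v => X v + Y v) v =
  \sum_(i < n.+1) iter (n - i) X (iter i Y v) *+ 'C(n, i).
Proof.
move=> aX aY XY; pose F i j := iter i X (iter j Y v).
have YF i j : Y (F i j) = F i j.+1.
  by rewrite /F; elim: i => //= i IH; rewrite -IH XY.
elim: n => [|n IH]; first by rewrite big_ord_recl big_ord0 /= addr0.
rewrite iterS {}IH (additive_op_sum _ aX) (additive_op_sum _ aY).
have -> : \sum_(i < n.+1) X (iter (n - i) X (iter i Y v) *+ 'C(n, i)) =
    F n.+1 0 + \sum_(i < n) F (n - i)%N i.+1 *+ 'C(n, i.+1).
  rewrite big_ord_recl subn0 bin0 additive_opMn //; congr (_ + _).
  by apply: eq_bigr => i _; rewrite additive_opMn // lift0 -iterS subnSK.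
have -> : \sum_(i < n.+1) Y (iter (n - i) X (iter i Y v) *+ 'C(n, i)) =
    \sum_(i < n.+1) F (n - i)%N i.+1 *+ 'C(n, i).
  by apply: eq_bigr => i _; rewrite additive_opMn // YF.
rewrite -addrA [RHS]big_ord_recl subn0 bin0; congr (_ + _).
rewrite [RHS](eq_bigr (fun i : 'I_n.+1 => F (n - i)%N i.+1 *+ 'C(n, i.+1) + F (n - i)%N i.+1 *+ 'C(n, i))).
  by rewrite big_split /=; congr (_ + _); rewrite [RHS]big_ord_recr /= bin_small // mulr0n addr0.
by move=> i _; rewrite lift0 subSS binS mulrnDr.
Qed.

(** The intermediate binomial coefficients are divisible by [p]. *)
Lemma iter_opD_prime p X Y v : prime p -> (forall v, v *+ p = 0) ->
  additive_op X -> additive_op Y -> (forall v, X (Y v) = Y (X v)) ->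
  iter p (fun v => X v + Y v) v = iter p X v + iter p Y v.
Proof.
move=> pp p0 aX aY XY; rewrite iter_opD //.
case: p pp p0 => // p pp p0.
rewrite big_ord_recl big_ord_recr !lift0 /= bin0 binn subnn big1 ?add0r //.
move=> i _; rewrite /bump leq0n add1n; have /dvdnP[k ->] : (p.+1 %| 'C(p.+1, i.+1))%N by apply: prime_dvd_bin => //=; rewrite ltnS.
by rewrite mulnC mulrnA p0 mul0rn.
Qed.

End AdditiveOperators.

(* The Weyl relation [u, s] = 1 makes P a free module over Z[u]/(u^p);
   c is division by (p-1)!. *)
Section Weyl.
Variables (V : zmodType) (p : nat) (u s c : V -> V) (P : V -> Prop).
Hypotheses (p_gt1 : (1 < p)%N) (au : additive_op u) (as_ : additive_op s)
  (uc : forall v, u (c v) = c (u v)) (cK : forall v, c (v *+ p.-1`!) = v)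
  (P0 : P 0) (PB : forall v w, P v -> P w -> P (v - w)) (Pc : forall v, P v -> P (c v))
  (Pu : forall v, P v -> P (u v)) (Ps : forall v, P v -> P (s v))
  (us : forall v, P v -> u (s v) = s (u v) + v).

Let P_iter f n v : (forall v, P v -> P (f v)) -> P v -> P (iter n f v).
Proof. by move=> Pf Pv; elim: n => //= n; apply: Pf. Qed.

Let u_iter_s v k : P v -> u v = 0 -> u (iter k.+1 s v) = iter k s v *+ k.+1.
Proof.
move=> Pv uv; elim: k => [|k IH]; first by rewrite /= us // uv additive_op0 // add0r.
rewrite iterS us; last exact: P_iter.
by rewrite IH additive_opMn // -iterS -mulrSr.
Qed.

Let u_iter_iter_s v k : P v -> u v = 0 -> iter k u (iter k s v) = v *+ k`!.
Proof.
move=> Pv uv; elim: k => // k IH; rewrite iterSr u_iter_s // additive_opMn.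
  by rewrite IH -mulrnA factS mulnC.
exact: additive_iter.
Qed.

(** On the kernel of [u] the relation gives [u^k s^k v = k! v]; take [k = p - 1] and divide. *)
Lemma weyl_ker v : P v -> u v = 0 -> exists2 b, P b & v = iter p.-1 u b.
Proof.
move=> Pv uv; exists (c (iter p.-1 s v)); first exact/Pc/P_iter.
have iZ n w : iter n u (c w) = c (iter n u w) by elim: n => //= n ->.
by rewrite iZ u_iter_iter_s // cK.
Qed.

(** Induction on the exponent: if [u^(j+1) v = 0], then [u^j v] is in the kernel of [u], hence
    equals [u^(p-1) b], and [v - u^(p-1-j) b] is killed by [u^j]. *)
Lemma weyl_ker_iter v : P v -> iter p.-1 u v = 0 -> exists2 b, P b & v = u b.
Proof.
have: (p.-1 < p)%N by rewrite prednK // ltnW.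
elim: p.-1 v => [|j IH] v jp Pv /= uv; first by exists 0; rewrite ?additive_op0.
have [b Pb ub] := weyl_ker (P_iter j Pu Pv) uv.
have pE : p.-1 = (j + (p - j.+2).+1)%N by lia.
have [||b' Pb' vE] := IH (v - u (iter (p - j.+2) u b)) (ltnW jp).
- exact/PB/Pu/P_iter.
- by rewrite additive_opB ?ub ?pE ?iterD ?subrr //; apply: additive_iter.
exists (b' - (0 - iter (p - j.+2) u b)); first by apply/PB/PB => //; apply: P_iter.
by rewrite sub0r opprK au -vE subrK.
Qed.

End Weyl.

(** * Alternating cochains *)

Section Alternating.
Variables (K : fieldType) (X : eqType).
Implicit Types (f : seq X -> K) (w : seq X).

(** Cochains are defined on all words, so the degree is expressed by vanishing on other lengths. In
    characteristic 2, [alt_repeat] does not follow from [alt_swap]. *)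
Record alternating (k : nat) f : Prop := Alternating {
  alt_size : forall w, size w != k -> f w = 0;
  alt_swap : forall s1 x y s2, f (s1 ++ x :: y :: s2) = - f (s1 ++ y :: x :: s2);
  alt_repeat : forall s1 x s2, f (s1 ++ x :: x :: s2) = 0 }.

Lemma alternating_cons k f a : alternating k.+1 f -> alternating k (fun s => f (a :: s)).
Proof.
case=> f1 f2 f3; split=> [w wk|s1 x y s2|s1 x s2]; first exact: f1.
  exact: (f2 (a :: s1)).
exact: (f3 (a :: s1)).
Qed.

Let subfE f g w : (f - g) w = f w - g w. Proof. by []. Qed.

Lemma alternatingB k f g : alternating k f -> alternating k g -> alternating k (f - g).
Proof.
move=> [f1 f2 f3] [g1 g2 g3]; split=> [w wk|s1 x y s2|s1 x s2]; rewrite ?subfE.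
- by rewrite f1 // g1 // subr0.
- by rewrite f2 g2 opprB opprK addrC.
- by rewrite f3 g3 subr0.
Qed.

Lemma alternating0 k : alternating k (0 : seq X -> K).
Proof. by split=> * //=; rewrite /= oppr0. Qed.

Lemma alternating_cobd k f : alternating k f -> alternating k.+1 (cobd f).
Proof.
move=> [f1 f2 f3]; split=> [w wk|s1 x y s2|s1 x s2].
- rewrite (@cobd_ext _ _ _ (fun _ => 0)) ?cobd0 // => s1 a s2 wE; apply: f1.
  by apply: contraNneq wk => <-; rewrite wE !size_cat addnS.
- elim: s1 f f2 {f1 f3} => [|a s1 IH] f f2 /=; last first.
    by rewrite f2 (IH (fun s => f (a :: s))) ?opprB ?opprK 1?addrC // => s; apply: (f2 (a :: s)).
  rewrite (@eq_cobd _ _ (fun s => f [:: x, y & s]) (fun s => - f [:: y, x & s])).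
    by rewrite cobdN; ring.
  by move=> s; apply: (f2 [::]).
- elim: s1 f f3 {f1 f2} => [|a s1 IH] f f3 /=; last first.
    by rewrite f3 (IH (fun s => f (a :: s))) ?subr0 // => s; apply: (f3 (a :: s)).
  rewrite (@eq_cobd _ _ (fun s => f [:: x, x & s]) (fun _ => 0)) ?cobd0; first by ring.
  by move=> s; apply: (f3 [::]).
Qed.

Lemma alternating_front k f s1 a s2 : alternating k f ->
  f (s1 ++ a :: s2) = (-1) ^+ size s1 * f (a :: s1 ++ s2).
Proof.
elim/last_ind: s1 s2 => [|s1 b IH] s2 af; first by rewrite mul1r.
by rewrite cat_rcons (alt_swap af) IH // size_rcons exprS cat_rcons; ring.
Qed.

Lemma alternating_nuniq k f w : alternating k f -> ~~ uniq w -> f w = 0.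
Proof.
elim: w k f => //= a w IH k f af; rewrite negb_and negbK => /orP[aw|nw].
  have /splitPr[s1 s2] := aw.
  by rewrite -cat_cons (alternating_front _ _ _ af) /= (alt_repeat af [::]) mulr0.
case: k af => [af|k af]; first by rewrite (alt_size af).
exact: (IH k _ (alternating_cons a af) nw).
Qed.

(** The sign depends on the two words only, so one exponent serves several cochains at once. *)
Lemma alternating_perm w w' : perm_eq w w' ->
  exists n, forall k f, alternating k f -> f w' = (-1) ^+ n * f w.
Proof.
elim: w w' => [|a w IH] w'.
  by rewrite perm_sym => /perm_nilP ->; exists 0%N => k f _; rewrite mul1r.
move=> pw; have : a \in w' by rewrite -(perm_mem pw) mem_head.
move=> aw; case/splitPr: aw pw => s1 s2.
rewrite perm_sym -(cat1s a s2) perm_catCA perm_cons perm_sym.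
move=> /IH[n hn]; exists (size s1 + n)%N => k f af.
rewrite (alternating_front _ _ _ af) exprD -mulrA; congr (_ * _).
case: k af => [af|k af]; last exact: (hn k _ (alternating_cons a af)).
by rewrite !(alt_size af) ?mulr0.
Qed.

Lemma alternating_colin k f g w w' : alternating k f -> alternating k g ->
  perm_eq w w' -> f w' * g w = f w * g w'.
Proof.
by move=> af ag /alternating_perm[n hn]; rewrite (hn _ _ af) (hn _ _ ag); ring.
Qed.

(** Prefixing [z] contracts the complex of all words, repetitions included. *)
Lemma cobd_cons_closed f z : (forall w, cobd f w = 0) -> f = cobd (fun s => f (z :: s)).
Proof. by move=> clf; apply/funext => w; have /= /eqP := clf (z :: w); rewrite subr_eq0 => /eqP. Qed.

End Alternating.

(** * Convolution with translations *)

Section Convolution.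
Variables (K : fieldType) (G : finZmodType) (p : nat).
Hypotheses (pK : p \in [pchar K]) (pG : forall g : G, g *+ p = 0).
Implicit Types (f : seq G -> K) (w : seq G) (m : seq G -> G -> K).

Definition translate (g : G) w := [seq a + g | a <- w].

Lemma size_translate g w : size (translate g w) = size w.
Proof. exact: size_map. Qed.

Lemma translateD g h w : translate g (translate h w) = translate (h + g) w.
Proof. by rewrite /translate -map_comp; apply: eq_map => a /=; rewrite addrA. Qed.

Lemma translate0 w : translate 0 w = w.
Proof. by rewrite /translate -[RHS]map_id; apply: eq_map => a; rewrite addr0. Qed.

(** The coefficients may depend on the word; if they do not, this is the action of an element of
    [K[G]]. *)
Definition convol m f w := \sum_g m w g * f (translate g w).

Definition tr_invariant (T : Type) (c : seq G -> T) := forall g w, c (translate g w) = c w.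

Lemma convol_additive m : additive_op (convol m).
Proof.
move=> f1 f2; apply/funext => w; rewrite -[RHS]/(convol m f1 w + convol m f2 w) /convol -big_split.
by apply: eq_bigr => g _; apply: mulrDr.
Qed.

Lemma convol_mul m c f : tr_invariant c ->
  convol m (fun w => c w * f w) = fun w => c w * convol m f w.
Proof.
move=> ci; apply/funext => w; rewrite /convol mulr_sumr.
by apply: eq_bigr => g _; rewrite ci; ring.
Qed.

Lemma convolC m m' f : tr_invariant m -> tr_invariant m' ->
  convol m (convol m' f) = convol m' (convol m f).
Proof.
move=> im im'; apply/funext => w; rewrite /convol.
under eq_bigr do rewrite mulr_sumr.
under [RHS]eq_bigr do rewrite mulr_sumr.
rewrite exchange_big; apply: eq_bigr => h _; apply: eq_bigr => g _.
by rewrite im im' !translateD [h + g]addrC; ring.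
Qed.

Let pp := pcharf_prime pK.

(** The summands commute, so the [p]-th power of the sum is the sum of the [p]-th powers; a
    translation has trivial [p]-th power, which leaves a multiplication operator. *)
Lemma convol_iter_prime m f w : tr_invariant m ->
  iter p (convol m) f w = (\sum_g m w g) ^+ p * f w.
Proof.
move=> im; pose T g f w := m w g * f (translate g w).
have mi g n f' w' : iter n (T g) f' w' = m w' g ^+ n * f' (translate (g *+ n) w').
  elim: n w' => [|n IH] w'; first by rewrite mul1r translate0.
  by rewrite iterS /T IH im translateD -mulrS exprS; ring.
(* Sums over lists, to add one translation at a time. *)
pose L l f w := \sum_(g <- l) T g f w.
have aT g : additive_op (T g).
  by move=> f1 f2; apply/funext => v; apply: mulrDr.
have LS g l : L (g :: l) = fun f => T g f + L l f.
  by apply/funext => f'; apply/funext => v; rewrite /L big_cons.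
have aL l : additive_op (L l).
  move=> f1 f2; apply/funext => v; rewrite -[RHS]/(L l f1 v + L l f2 v) /L -big_split.
  by apply: eq_bigr => g _; rewrite aT.
have TL g l f' : T g (L l f') = L l (T g f').
  apply/funext => v; rewrite /L /T mulr_sumr; apply: eq_bigr => h _.
  by rewrite !im !translateD [h + g]addrC; ring.
have -> : convol m = L (index_enum G) by [].
elim: (index_enum G) => [|g l IH].
  rewrite big_nil expr0n gtn_eqF ?prime_gt0 // mul0r -(prednK (prime_gt0 pp)) iterS.
  by rewrite /L big_nil.
rewrite LS iter_opD_prime //; last first.
  move=> f'; apply/funext => v; have -> : (f' *+ p) v = f' v *+ p by elim: p => // n IHn; rewrite !mulrS -IHn.
  by rewrite -mulr_natr (pcharf0 pK) mulr0.
rewrite -[LHS]/(iter p (T g) f w + iter p (L l) f w) IH mi pG translate0 big_cons -mulrDl.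
by rewrite -!(pFrobenius_autE pK) rmorphD.
Qed.

End Convolution.

(** * Freeness over [K[u]/(u^p)] in intermediate degrees *)

Section Equivariant.
Variables (K : fieldType) (G : finZmodType) (p : nat).
Hypotheses (pK : p \in [pchar K]) (pG : forall g : G, g *+ p = 0).
Variable m0 : G -> K.
Hypothesis sum_m0 : \sum_g m0 g = 0.
Implicit Types (f : seq G -> K) (w : seq G) (S T : {set G}).

Definition shift h S := [set x + h | x in S].

Lemma shiftD g h S : shift g (shift h S) = shift (h + g) S.
Proof. by rewrite /shift -imset_comp; apply: eq_imset => x /=; rewrite addrA. Qed.

Lemma shift0 S : shift 0 S = S.
Proof. by rewrite /shift -[RHS]imset_id; apply: eq_imset => x; rewrite addr0. Qed.

(* l witnesses that convolution by m0 acts freely on the functions on the orbit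
   of S, see [alternating_free]. *)
Hypothesis functional : forall S, S != finset.set0 -> S != finset.setT -> exists l : G -> K,
  [/\ {morph l : a b / a + b}, forall h, shift h S = S -> l h = 0 & \sum_g m0 g * l g != 0].

(** [lam] evaluates the functional on the displacement from a chosen representative of the orbit;
    the choice of displacement is immaterial because the functional vanishes on the stabilizer. *)
Lemma orbit_slope : exists (lam : {set G} -> K) (l : {set G} -> G -> K),
  (forall S, S != finset.set0 -> S != finset.setT -> \sum_g m0 g * l S g != 0) /\
  (forall S h, l (shift h S) = l S /\ lam (shift h S) = lam S + l S h).
Proof.
have /choice[L hL] : forall S, exists l : G -> K,
    [/\ {morph l : a b / a + b}, forall h, shift h S = S -> l h = 0 &
        S != finset.set0 -> S != finset.setT -> \sum_g m0 g * l g != 0].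
  move=> S; have [S0|S0] := boolP (S != finset.set0); last first.
    by exists (fun=> 0); split=> // a b; rewrite addr0.
  have [ST|ST] := boolP (S != finset.setT); last first.
    by exists (fun=> 0); split=> // a b; rewrite addr0.
  by have [l [l1 l2 l3]] := functional S0 ST; exists l.
pose orb S := [set shift h S | h in G].
(* [rep] depends on the orbit only, so translates share it; neither default is ever reached. *)
pose rep S := odflt S [pick T in orb S].
pose t S := odflt 0 [pick h | shift h (rep S) == S].
have orbE S h : orb (shift h S) = orb S.
  apply/setP => T; apply/finset.imsetP/finset.imsetP => -[g _ ->].
    by exists (h + g); rewrite ?shiftD.
  by exists (g - h); rewrite ?shiftD // addrC subrK.
have repE S h : rep (shift h S) = rep S.
  rewrite /rep orbE; case: pickP => // /(_ S)/negP[].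
  by apply/finset.imsetP; exists 0; rewrite ?shift0.
have tE S : shift (t S) (rep S) = S.
  rewrite /t; case: pickP => [h /eqP//|/=]; rewrite /rep.
  case: pickP => [T /finset.imsetP[g _ ->] /= /(_ (- g))|_ /(_ 0)/=].
    by move/negP=> []; rewrite shiftD subrr shift0.
  by move/negP=> []; rewrite shift0.
have repo S : exists g, rep S = shift g S.
  rewrite /rep; case: pickP => [T /finset.imsetP[g _ ->]|_]; first by exists g.
  by exists 0; rewrite shift0.
exists (fun S => L (rep S) (t S)), (fun S => L (rep S)); split=> [S S0 ST|S h].
  have [_ _] := hL (rep S); apply; have [g ->] := repo S.
    apply: contraNneq S0 => Sg; rewrite -(shift0 S) -(subrr g) -shiftD Sg.
    by rewrite /shift imset0.
  apply: contraNneq ST => Sg; apply/eqP/setP => x; rewrite inE.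
  have : x + g \in shift g S by rewrite Sg inE.
  by move=> /finset.imsetP[y yS /addIr ->].
rewrite !repE; split=> //; have [Lm Ls _] := hL (rep S).
have tEh : shift (t (shift h S)) (rep S) = shift h S by rewrite -{1}(repE S h) tE.
have hS : shift h S = shift (t S + h) (rep S) by rewrite -shiftD tE.
(* The two translations carrying [rep S] to [shift h S] differ by an element of the stabilizer of
   [rep S]. *)
have -> : t (shift h S) = (t (shift h S) - (t S + h)) + (t S + h) by rewrite subrK.
rewrite Lm [L _ (t _ - _)]Ls ?add0r ?Lm //.
by rewrite -shiftD tEh hS shiftD subrr shift0.
Qed.

Let u f := convol (fun _ => m0) f.
Local Notation r := #|G|.

Lemma alternating_convol k m f :
  (forall w w', w =i w' -> m w = m w') -> alternating k f -> alternating k (convol m f).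
Proof.
move=> mE [f1 f2 f3]; split=> [w wk|s1 x y s2|s1 x s2]; rewrite /convol.
- by apply: big1 => g _; rewrite f1 ?mulr0 // size_translate.
- rewrite -sumrN; apply: eq_bigr => g _; rewrite /translate !map_cat /= f2 mulrN.
  congr (- (_ * _)); apply: (congr1 (@^~ g)); apply: mE => z.
  by rewrite !mem_cat !inE [X in _ || X]orbCA.
- by apply: big1 => g _; rewrite /translate map_cat /= f3 mulr0.
Qed.

(** The commutator of [u] with multiplication by [lam] is [convol m1], which commutes with [u] and
    whose [p]-th power is multiplication by [a]. So [lam] followed by the power [p - 1] of
    [convol m1] has commutator [a] with [u], and dividing by [a] gives [s]. *)
Lemma alternating_free k : (0 < k < r)%N -> exists s : (seq G -> K) -> seq G -> K,
  [/\ additive_op s, forall f, alternating k f -> alternating k (s f) &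
      forall f, alternating k f -> u (s f) = s (u f) + f].
Proof.
move=> /andP[k0 kr]; have [lam [l [l0 lE]]] := orbit_slope.
pose S w := [set x in w].
have SE g w : S (translate g w) = shift g (S w).
  apply/setP => x; rewrite inE; apply/mapP/finset.imsetP => -[y yw ->]; exists y => //.
    by rewrite inE.
  by move: yw; rewrite inE.
have Seq w w' : w =i w' -> S w = S w' by move=> ww'; apply/setP => x; rewrite !inE.
pose m1 w g := m0 g * l (S w) g.
have m1i : tr_invariant m1 by move=> g w; rewrite /m1 SE (lE _ _).1.
have m0i : tr_invariant (fun _ => m0) by [].
pose a w := (\sum_g m1 w g) ^+ p.
have ai : tr_invariant (fun w => (a w)^-1) by move=> g w; rewrite /a m1i.
pose B f := iter p.-1 (convol m1) (fun w => lam (S w) * f w).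
have uB f : u (iter p.-1 (convol m1) f) = iter p.-1 (convol m1) (u f).
  by elim: p.-1 => // n IH; rewrite !iterS -IH /u convolC.
have ulam f : u (fun w => lam (S w) * f w) = (fun w => lam (S w) * u f w) + convol m1 f.
  apply/funext => w; rewrite -[RHS]/(lam (S w) * u f w + convol m1 f w) /u /convol.
  rewrite mulr_sumr -big_split; apply: eq_bigr => g _ /=.
  by rewrite SE (lE _ _).2 /m1; ring.
have aB : additive_op B.
  move=> f g; rewrite /B -additive_iter; last exact: convol_additive.
  by congr iter; apply/funext => w; apply: mulrDr.
exists (fun f w => (a w)^-1 * B f w); split=> [f g|f af|f af].
- by apply/funext => w; rewrite aB; apply: mulrDr.
- have aBf : alternating k (B f).
    rewrite /B; elim: p.-1 => [|n IH] /=.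
      have [f1 f2 f3] := af; split=> [w wk|s1 x y s2|s1 x s2].
      + by rewrite f1 ?mulr0.
      + rewrite f2 mulrN; congr (- (lam _ * _)); apply: Seq => z.
        by rewrite !mem_cat !inE [X in _ || X]orbCA.
      + by rewrite f3 mulr0.
    by apply: alternating_convol => // w w' /Seq ww'; rewrite /m1 ww'.
  have [f1 f2 f3] := aBf; split=> [w wk|s1 x y s2|s1 x s2].
  + by rewrite f1 ?mulr0.
  + rewrite f2 mulrN; congr (- (_^-1 * _)); rewrite /a /m1 (Seq _ (s1 ++ [:: y, x & s2])) //.
    by move=> z; rewrite !mem_cat !inE [X in _ || X]orbCA.
  + by rewrite f3 mulr0.
- rewrite {1}/u convol_mul // -/(u _) uB ulam additive_iter; last exact: convol_additive.
  rewrite -iterSr prednK ?prime_gt0 ?(pcharf_prime pK) //.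
  apply/funext => w.
  rewrite -[RHS]/((a w)^-1 * B (u f) w + f w) -[iter p.-1 _ _ + _]/(fun w => B (u f) w + iter p (convol m1) f w).
  rewrite mulrDr; congr (_ + _); rewrite (convol_iter_prime pK pG) // -/(a w) mulrA.
  (* Off the injective words of length [k], where [a w] need not be invertible, [f w] vanishes. On
     them, the set of letters is nonempty and proper. *)
  have [wk|wk] := eqVneq (size w) k; last by rewrite (alt_size af) // mulr0.
  have [uw|nuw] := boolP (uniq w); last by rewrite (alternating_nuniq af) // mulr0.
  rewrite mulVf ?mul1r // expf_neq0 //; apply: l0.
    by apply/finset.set0Pn; case: w wk uw => [wk|x w _ _]; [rewrite -wk in k0|exists x; rewrite inE mem_head].
  by rewrite eqEcard finset.subsetT /= cardsT cardsE (card_uniqP uw) wk -ltnNge.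
Qed.

(* The two differentials of the periodic resolution over K[u]/(u^p) *)
Definition tate_op b f := iter (if b then 1 else p.-1) u f.

Lemma u_additive : additive_op u. Proof. exact: convol_additive. Qed.

Lemma iter_prime_u f : iter p u f = 0.
Proof.
apply/funext => w; rewrite (convol_iter_prime pK pG) // sum_m0.
by rewrite expr0n gtn_eqF ?prime_gt0 ?(pcharf_prime pK) // mul0r.
Qed.

Lemma tate_op_negb b f : tate_op b (tate_op (~~ b) f) = 0.
Proof.
rewrite -[RHS](iter_prime_u f) /tate_op -iterD.
have : (0 < p)%N by rewrite prime_gt0 ?(pcharf_prime pK).
by case: p; case: b => //= n _; rewrite ?addn1.
Qed.

Lemma alternating_tate_op b k f : alternating k f -> alternating k (tate_op b f).
Proof.
by move=> af; rewrite /tate_op; elim: (if b then _ else _) => //= n; apply: alternating_convol.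
Qed.

(** [alternating_free] provides the Weyl relation, so the kernel of each of [u] and [u^(p-1)] is the
    image of the other. *)
Lemma tate_op_exact b k f : (0 < k < r)%N -> alternating k f -> tate_op b f = 0 ->
  exists2 g, alternating k g & f = tate_op (~~ b) g.
Proof.
move=> /alternating_free[s [as_ sa us]] af uf.
(* Division by [(p-1)!], which is nonzero in characteristic [p]. *)
pose c f (w : seq G) := (p.-1`!)%:R^-1 * f w : K.
have pp := pcharf_prime pK.
have fp : (p.-1`!)%:R != 0 :> K.
  rewrite -(dvdn_pcharf pK).
  have: (p.-1 < p)%N by rewrite prednK // prime_gt0.
  elim: p.-1 => [|n IH] np; first by rewrite fact0 dvdn1 gtn_eqF ?prime_gt1.
  rewrite factS Euclid_dvdM // negb_or IH ?andbT ?gtnNdvd //; exact: ltnW.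
have uc g : u (c g) = c (u g) by rewrite /u convol_mul.
have cK g : c (g *+ p.-1`!) = g.
  apply/funext => w; rewrite /c; have -> : (g *+ p.-1`!) w = g w *+ p.-1`!.
    by elim: _`! => // n IH; rewrite !mulrS -IH.
  by rewrite -[X in _ * X]mulr_natl mulKf.
have ca g : alternating k g -> alternating k (c g).
  move=> [f1 f2 f3]; rewrite /c; split=> [w wk|s1 x y s2|s1 x s2].
  - by rewrite f1 ?mulr0.
  - by rewrite f2 mulrN.
  - by rewrite f3 mulr0.
have ua g : alternating k g -> alternating k (u g) by exact: (alternating_tate_op true).
case: b uf => /= uf.
  by have [g] := weyl_ker u_additive as_ uc cK ca sa us af uf; exists g.
have [||g] := weyl_ker_iter (prime_gt1 pp) u_additive as_ uc cK _ _ ca ua sa us af uf.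
- exact: alternating0.
- exact: alternatingB.
by exists g.
Qed.

End Equivariant.

(** * The zigzag from the top degree to a constant *)

Section Obstruction.
Variables (K : fieldType) (G : finZmodType) (p n : nat).
Hypotheses (pK : p \in [pchar K]) (pG : forall g : G, g *+ p = 0) (cG : #|G| = n.+1).
Variable m0 : G -> K.
Hypothesis sum_m0 : \sum_g m0 g = 0.
Hypothesis functional : forall S : {set G}, S != finset.set0 -> S != finset.setT -> exists l : G -> K,
  [/\ {morph l : a b / a + b}, forall h, shift h S = S -> l h = 0 & \sum_g m0 g * l g != 0].
Implicit Types (f : seq G -> K) (w : seq G).
Local Notation u := (convol (fun _ => m0)).
Local Notation tate := (tate_op p m0).

Lemma cobd_convol f : cobd (u f) = u (cobd f).
Proof.
apply/funext => w; rewrite /convol cobd_sum; apply: eq_bigr => g _.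
by rewrite cobdZ /translate cobd_map.
Qed.

Lemma cobd_tate b f : cobd (tate b f) = tate b (cobd f).
Proof.
rewrite /tate_op; elim: (if b then _ else _) => //= k IH.
by rewrite cobd_convol IH.
Qed.

Lemma tate_additive b : additive_op (tate b).
Proof. exact/additive_iter/u_additive. Qed.

Lemma p_gt1 : (1 < p)%N. Proof. exact: prime_gt1 (pcharf_prime pK). Qed.

Lemma tate_pos b : exists k, forall f, tate b f = iter k.+1 (fun f => u f) f.
Proof.
case: b; first by exists 0%N.
by exists p.-2 => f; have := p_gt1; case: p => [|[]].
Qed.

Lemma tate_invariant b f : tr_invariant f -> tate b f = 0.
Proof.
have [k ->] := tate_pos b => fi; rewrite iterSr.
have -> : u f = 0.
  apply/funext => w; rewrite /convol; under eq_bigr do rewrite fi.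
  by rewrite -mulr_suml sum_m0 mul0r.
exact: additive_op0 (additive_iter _ (u_additive m0)).
Qed.

Lemma tate_nil b f : tate b f [::] = 0.
Proof. by have [k ->] := tate_pos b; rewrite iterS /convol /translate /= -mulr_suml sum_m0 mul0r. Qed.

Lemma injword_translate k g w : injword finset.setT k (translate g w) = injword finset.setT k w.
Proof.
rewrite /injword size_translate (map_inj_uniq (addIr g)); congr [&& _, _ & _].
by apply/allP/allP => _ x _; rewrite inE.
Qed.

Lemma eq_tate b k f g : (forall w, injword finset.setT k w -> f w = g w) ->
  forall w, injword finset.setT k w -> tate b f w = tate b g w.
Proof.
move=> fg; rewrite /tate_op; elim: (if b then _ else _) => //= i IH w hw.
by apply: eq_bigr => h _; rewrite IH ?injword_translate.
Qed.

Variable e : seq G -> K.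
Hypotheses (ae : alternating n.+1 e) (ei : tr_invariant e)
  (e0 : exists w, e w != 0).

(** Injective words of length [n.+1] are permutations of one another, so every top cochain is a
    multiple of the invariant [e]. *)
Lemma top_invariant f : alternating n.+1 f -> tr_invariant f.
Proof.
move=> af g w; have [hw|hw] := boolP (injword finset.setT n.+1 w); last first.
  have vanish (v : seq G) : ~~ injword finset.setT n.+1 v -> f v = 0.
    rewrite /injword negb_and => /orP[uv|]; first exact: (alternating_nuniq af uv).
    rewrite negb_and => /orP[/negP[]|sv]; last exact: (alt_size af sv).
    by apply/allP => x _; rewrite inE.
  by rewrite !vanish // injword_translate.
have full (v : seq G) : injword finset.setT n.+1 v -> forall x, x \in v.
  move=> /and3P[uv _ /eqP sv] x.
  have /(_ x) -> : v =i [set: G]; last by rewrite finset.in_setT.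
  apply/subset_cardP; first by rewrite cardsT cG (card_uniqP uv).
  by apply/fintype.subsetP => y yv; rewrite finset.in_setT.
have perm (v v' : seq G) : injword finset.setT n.+1 v -> injword finset.setT n.+1 v' -> perm_eq v v'.
  move=> hv hv'; apply: uniq_perm; [by case/and3P: hv|by case/and3P: hv'|].
  by move=> x; rewrite !full.
have [w0 ew0] := e0.
have hw0 : injword finset.setT n.+1 w0.
  apply/and3P; split; last 1 first.
  - by apply: contraNT ew0 => sw0; rewrite (alt_size ae sw0).
  - by apply: contraNT ew0 => uw0; rewrite (alternating_nuniq ae uw0).
  - by apply/allP => x _; rewrite inE.
have ew : e w != 0.
  have [k hk] := alternating_perm K (perm _ _ hw0 hw).
  by rewrite (hk _ _ ae) mulf_neq0 // signr_eq0.
have hgw : injword finset.setT n.+1 (translate g w) by rewrite injword_translate.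
have := alternating_colin af ae (perm _ _ hw hgw); rewrite ei; exact: mulIf.
Qed.

(** Prefixing 0 gives a primitive of a closed cochain, so each term is a primitive of [tate] of the
    preceding one. The operators alternate, starting with [u], and [descent j] has degree
    [n - j]. *)
Fixpoint descent j : seq G -> K :=
  if j is i.+1 then fun s => tate (~~ odd i) (descent i) (0 :: s)
  else fun s => e (0 :: s).

Lemma cobd_descent0 : cobd (descent 0) = e.
Proof.
apply/esym/cobd_cons_closed => w.
(* [cobd e] has degree [n.+2], more than the number of elements of [G]. *)
have ace := alternating_cobd ae; have [uw|] := boolP (uniq w); last by move=> nu; exact: (alternating_nuniq ace nu).
apply: (alt_size ace); rewrite -cG; apply/eqP => sw.
by have := max_card [in w]; rewrite (card_uniqP uw) sw ltnn.
Qed.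

Lemma alternating_descent j : (j <= n)%N -> alternating (n - j)%N (descent j).
Proof.
elim: j => [_|j IH jn]; first by rewrite subn0; apply: alternating_cons.
apply: alternating_cons; rewrite subnSK //; apply: alternating_tate_op.
exact/IH/ltnW.
Qed.

(** The right-hand side is closed: for [j = 0] because [tate] kills the invariant [e], later because
    consecutive operators compose to 0. *)
Lemma cobd_descent j : cobd (descent j.+1) = tate (~~ odd j) (descent j).
Proof.
elim: j => [|j IH]; apply/esym/cobd_cons_closed => w; rewrite cobd_tate.
  by rewrite cobd_descent0 tate_invariant.
by rewrite IH /= negbK (tate_op_negb pK pG sum_m0).
Qed.

(** If the constant were 0, exactness would write every term, back up to [descent 0], as a
    coboundary plus an image of [tate]. Then [e] would be [u^(p-1)] of a top cochain, which is 0 by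
    invariance. *)
Lemma descent_n_neq0 : descent n [::] != 0.
Proof.
apply/eqP => dn0.
have desc0 : descent n = 0.
  apply/funext => -[//|x w].
  by rewrite (alt_size (alternating_descent (leqnn n))) // subnn.
have free j : (j <= n)%N -> exists b c, alternating (n - j)%N b /\
    descent j = cobd c + tate (odd j) b.
  move=> jn; rewrite -(subKn jn); elim: {j jn}(n - j)%N (leq_subr j n) => [_|i IH i_n].
    rewrite subn0 desc0 subnn; exists 0, 0; split; first exact: alternating0.
    rewrite (additive_op0 (tate_additive _)) addr0; apply/funext => w.
    by rewrite (eq_cobd (g := fun=> 0)) ?cobd0.
  have [b [c [ab dE]]] := IH (ltnW i_n).
  set j := (n - i.+1)%N in dE *; have jE : (n - i = j.+1)%N by rewrite /j; lia.
  rewrite jE in dE ab.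
  have acb : alternating (n - j)%N (cobd b).
    by rewrite (_ : n - j = (n - j.+1).+1)%N; [apply: alternating_cobd|rewrite /j; lia].
  (* The coboundary of the decomposition of [descent j.+1] puts this difference in the kernel of one
     operator, hence in the image of the other. *)
  have : tate (~~ odd j) (descent j - cobd b) = 0.
    rewrite additive_opB; last exact: tate_additive.
    rewrite -cobd_descent dE /=; apply/eqP; rewrite subr_eq0; apply/eqP/funext => w.
    by rewrite -cobd_tate -[LHS]/(cobd (fun s => cobd c s + tate (~~ odd j) b s) w) cobdD cobd_cobd add0r.
  move=> /(tate_op_exact pK pG functional) H.
  have [||b' ab'] := H (n - j)%N.
  - by rewrite cG /j; lia.
  - by apply: alternatingB => //; apply: alternating_descent; rewrite /j; lia.
  by rewrite negbK => /eqP; rewrite subr_eq addrC => /eqP dE'; exists b', b.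
have [b [c [ab dE]]] := free 0%N isT.
have [w /eqP] := e0; apply.
rewrite -cobd_descent0 dE -[LHS]/(cobd (fun s => cobd c s + tate false b s) w) cobdD cobd_cobd add0r cobd_tate tate_invariant //.
by apply: top_invariant; apply: alternating_cobd; rewrite subn0 in ab.
Qed.

Variable Phi : (seq G -> K) -> seq G -> K.
Hypotheses (Phi_nil : forall f, Phi f [::] = f [::])
  (Phi_cobd : forall f w, uniq w -> cobd (Phi f) w = Phi (cobd f) w)
  (Phi_convol : forall f w, uniq w -> Phi (u f) w = u (Phi f) w).

(** Otherwise exactness of injective words writes every [Phi (descent j)] as an image of [tate] plus
    a coboundary. Both vanish at the empty word, where [Phi] preserves the nonzero constant [descent
    n [::]]. *)
Theorem obstruction : exists2 w, injword finset.setT n.+1 w & Phi e w != 0.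
Proof.
apply: contrapT => Phie; move/eqP: descent_n_neq0; apply.
have unq k w : injword finset.setT k w -> uniq w by case/andP.
have Phi_op b f k w : injword finset.setT k w -> Phi (tate b f) w = tate b (Phi f) w.
  rewrite /tate_op; move: w; elim: (if b then _ else _) => // i IH w hw /=.
  rewrite Phi_convol ?(unq k) //; apply: eq_bigr => g _.
  by rewrite IH ?injword_translate.
have fill j : (j <= n)%N -> exists c c', forall w, injword finset.setT (n - j)%N w ->
    Phi (descent j) w = tate (odd j) c w + cobd c' w.
  elim: j => [_|j IH jn].
    have [||c' hc'] := @injword_exact K G finset.setT n (Phi (descent 0)).
    - by rewrite cardsT cG.
    - move=> w hw; rewrite Phi_cobd ?(unq _ _ hw) // cobd_descent0.
      by apply/eqP/negP => /negP Pe; apply: Phie; exists w.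
    exists 0, c' => w; rewrite subn0 => /hc' ->.
    by rewrite (additive_op0 (tate_additive _)) add0r.
  have [c [c' hc]] := IH (ltnW jn).
  pose D := tate (~~ odd j).
  (* Subtracting [D c'] makes the cochain closed: [D] commutes with [cobd] and kills the [tate] part
     of [Phi (descent j)]. *)
  have [||c'' hc''] := @injword_exact K G finset.setT (n - j.+1)%N (Phi (descent j.+1) - D c').
  - by rewrite cardsT cG; lia.
  - move=> w; rewrite subnSK // => hw.
    rewrite -[LHS]/(cobd (fun s => Phi (descent j.+1) s - D c' s) w) cobdB.
    rewrite Phi_cobd ?(unq _ _ hw) // cobd_descent (Phi_op _ _ _ _ hw).
    rewrite (eq_tate _ hc hw) -[X in tate _ X]/(tate (odd j) c + cobd c') tate_additive.
    rewrite -[in tate (odd j) c](negbK (odd j)) (tate_op_negb pK pG sum_m0) add0r.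
    by rewrite /D cobd_tate subrr.
  exists c', c'' => w /hc'' /eqP.
  by rewrite -[X in X == _]/(Phi (descent j.+1) w - D c' w) subr_eq addrC => /eqP.
have [c [c' hc]] := fill n (leqnn n).
have := hc [::]; rewrite subnn /injword /= Phi_nil tate_nil add0r => -> //.
Qed.

End Obstruction.

(** * An invariant alternating cochain of top degree *)

Section Vandermonde.
Variables (K : fieldType) (G : finZmodType) (x : G -> K) (k : nat).
Hypotheses (x_add : {morph x : a b / a + b}) (x_inj : injective x).

Fixpoint vdm (w : seq G) : K :=
  if w is a :: v then \prod_(b <- v) (x b - x a) * vdm v else 1.

Definition top_vdm (w : seq G) := if size w == k then vdm w else 0.

Lemma alternating_top_vdm : alternating k top_vdm.
Proof.
rewrite /top_vdm; split=> [w /negbTE -> //|s1 a b s2|s1 a s2].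
  rewrite !size_cat /=; case: ifP => _; last by rewrite oppr0.
  elim: s1 => /= [|c s1 ->].
    by rewrite !big_cons; ring.
  rewrite mulrN !big_cat !big_cons /=; ring.
case: ifP => // _; elim: s1 => /= [|c s1 ->]; last by rewrite mulr0.
by rewrite big_cons subrr !mul0r.
Qed.

Lemma top_vdm_translate : tr_invariant top_vdm.
Proof.
move=> g w; rewrite /top_vdm size_translate; case: ifP => // _.
elim: w => //= a w ->; rewrite big_map; congr (_ * _).
by apply: eq_bigr => b _; rewrite !x_add; ring.
Qed.

Lemma top_vdm_neq0 w : uniq w -> size w = k -> top_vdm w != 0.
Proof.
rewrite /top_vdm => uw ->; rewrite eqxx.
elim: w uw => /= [|a w IH /andP[aw uw]]; first by rewrite oner_eq0.
rewrite mulf_neq0 ?IH // prodf_seq_neq0; apply/allP => b bw /=.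
by rewrite subr_eq0; apply: contraNneq aw => /x_inj <-.
Qed.

End Vandermonde.

(** * The elementary abelian group and rational functions over the prime field *)

Section ElementaryAbelian.
Variables (p nu : nat).
Hypothesis pp : prime p.
Local Notation G := 'rV['F_p]_nu.
Definition ratfrac := {fraction {poly 'F_p}}.
Local Notation K := ratfrac.

(** An additive embedding of [G] into [K], to be used in the Vandermonde product. *)
Definition coord_frac (g : G) : K := tofrac (rVpoly g).

Lemma coord_frac_add : {morph coord_frac : a b / a + b}.
Proof. by move=> a b; rewrite /coord_frac !raddfD. Qed.

Lemma coord_frac_inj : injective coord_frac.
Proof.
move=> a b /eqP; rewrite /coord_frac tofrac_eq => /eqP h; by rewrite -[a]rVpolyK h rVpolyK.
Qed.

Lemma pchar_ratfrac : p \in [pchar K].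
Proof.
rewrite inE pp; apply/eqP; rewrite -(rmorph_nat (@tofrac {poly 'F_p})) -polyC_natr.
by rewrite (pcharf0 (pchar_Fp pp)) polyC0 rmorph0.
Qed.

Lemma rV_torsion (g : G) : g *+ p = 0.
Proof.
apply/rowP => j; rewrite mulmxnE mxE -mulr_natr.
by rewrite (pcharf0 (pchar_Fp pp)) mulr0.
Qed.

(* The element u of K[G]. Functions on G/H with H proper are free over its powers
   because the X^i are linearly independent over F_p. *)
Definition shifted_gen (g : G) : K :=
  \sum_(i < nu) tofrac 'X^i * ((g == delta_mx 0 i)%:R - (g == 0)%:R).

Lemma sum_shifted_gen (l : G -> K) :
  \sum_g shifted_gen g * l g = \sum_(i < nu) tofrac 'X^i * (l (delta_mx 0 i) - l 0).
Proof.
under eq_bigr do rewrite mulr_suml.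
rewrite exchange_big; apply: eq_bigr => i _.
under eq_bigr do rewrite -mulrA.
rewrite -mulr_sumr; congr (_ * _).
under eq_bigr do rewrite mulrBl.
rewrite sumrB; congr (_ - _).
  rewrite (bigD1 (delta_mx 0 i)) //= eqxx mul1r big1 ?addr0 // => g /negbTE ->.
  by rewrite mul0r.
rewrite (bigD1 0) //= eqxx mul1r big1 ?addr0 // => g /negbTE ->.
by rewrite mul0r.
Qed.

(** The stabilizer is a linear subspace, proper because translations are transitive on [G]. A
    nonzero column of the cokernel of the matrix listing its elements is the required linear
    form. *)
Lemma stabilizer_functional (S : {set G}) : S != finset.set0 -> S != finset.setT ->
  exists2 c : 'cV['F_p]_nu, c != 0 & forall h, shift h S = S -> h *m c = 0.
Proof.
move=> S0 ST; pose H := [set h | shift h S == S].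
pose M := \matrix_(i < #|H|) enum_val i.
have H0 : 0 \in H by rewrite inE shift0.
have HD g h : g \in H -> h \in H -> g + h \in H.
  by rewrite !inE -shiftD => /eqP -> ->.
have HM h k : h \in H -> h *+ k \in H.
  by move=> hH; elim: k => [|k IH]; rewrite ?mulr0n // mulrS HD.
have nfull : ~~ row_full M.
  apply: contra ST => fM; have allH h : h \in H.
    have /submxP[D ->] : (h <= M)%MS by apply: submx_full.
    rewrite mulmx_sum_row; apply: (big_ind (fun y => y \in H)) => // i _.
    by rewrite rowK -[D 0 i]natr_Zp scaler_nat HM ?enum_valP.
  apply/eqP/setP => y; rewrite inE; have /finset.set0Pn[z zS] := S0.
  have := allH (y - z); rewrite inE => /eqP <-.
  by apply/finset.imsetP; exists z; rewrite // addrC subrK.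
have : cokermx M != 0 by rewrite cokermx_eq0.
case/matrix0Pn => i [j cij]; exists (col j (cokermx M)).
  by apply/matrix0Pn; exists i, 0; rewrite mxE.
move=> h hS; have hH : h \in H by rewrite inE hS.
have -> : h = row (enum_rank_in hH h) M by rewrite rowK enum_rankK_in.
by rewrite colE mulmxA -row_mul mulmx_coker row0 mul0mx.
Qed.

(** With the functional given by [c], the sum is the polynomial with coefficients [c], which is
    nonzero. *)
Lemma shifted_gen_free (S : {set G}) : S != finset.set0 -> S != finset.setT -> exists l : G -> K,
  [/\ {morph l : a b / a + b}, forall h, shift h S = S -> l h = 0 &
      \sum_g shifted_gen g * l g != 0].
Proof.
move=> S0 ST; have [c c0 cS] := stabilizer_functional S0 ST.
exists (fun g => tofrac ((g *m c) 0 0)%:P); split=> [a b|h /cS ->|].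
- by rewrite mulmxDl mxE polyCD tofracD.
- by rewrite mxE polyC0 tofrac0.
rewrite sum_shifted_gen mul0mx mxE polyC0 tofrac0.
under eq_bigr do rewrite subr0 -rowE mxE -tofracM mulrC mul_polyC -rVpoly_delta -linearZ.
rewrite -raddf_sum tofrac_eq0 -raddf_sum.
have -> : \sum_(i < nu) c i 0 *: delta_mx 0 i = c^T.
  by rewrite [RHS]row_sum_delta; apply: eq_bigr => i _; rewrite mxE.
apply: contra_neq c0 => c0; rewrite -[c]trmxK -[c^T]rVpolyK c0.
by apply/matrixP => i j; rewrite !mxE coef0.
Qed.

Theorem elementary_abelian_obstruction (Phi : (seq G -> K) -> seq G -> K) :
  (forall f, Phi f [::] = f [::]) ->
  (forall f h w, Phi (fun s => f s + h s) w = Phi f w + Phi h w) ->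
  (forall k f w, Phi (fun s => k * f s) w = k * Phi f w) ->
  (forall f w, uniq w -> cobd (Phi f) w = Phi (cobd f) w) ->
  (forall f g w, uniq w -> Phi (fun s => f (translate g s)) w = Phi f (translate g w)) ->
  exists e w, [/\ alternating #|G| e, injword finset.setT #|G| w & Phi e w != 0].
Proof.
move=> Phi0 PhiD PhiZ Phid Phit; have [n cG] : exists n, #|G| = n.+1.
  by exists #|G|.-1; rewrite prednK //; apply/card_gt0P; exists 0.
have e0 : exists w, top_vdm coord_frac n.+1 w != 0.
  exists (enum G); apply: top_vdm_neq0; rewrite ?enum_uniq //; first exact: coord_frac_inj.
  by rewrite -cardE cG.
have [||w hw Pw] := @obstruction K G p n pchar_ratfrac rV_torsion cG shifted_gen _
    shifted_gen_free (top_vdm coord_frac n.+1) (alternating_top_vdm _ _)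
    (top_vdm_translate _ coord_frac_add) e0 Phi Phi0 Phid.
- have := sum_shifted_gen (fun=> 1); under eq_bigr do rewrite mulr1.
  by move=> ->; apply: big1 => i _; rewrite subrr mulr0.
- move=> f w uw; rewrite /convol; elim: (index_enum G) => [|g l IH].
    rewrite big_nil -[RHS](mul0r (Phi f w)) -PhiZ; congr Phi.
    by apply/funext => s; rewrite big_nil mul0r.
  rewrite big_cons -IH -Phit // -PhiZ -PhiD; congr Phi.
  by apply/funext => s; rewrite big_cons.
by rewrite cG; exists (top_vdm coord_frac n.+1), w; split=> //; apply: alternating_top_vdm.
Qed.

End ElementaryAbelian.

(** * Equivariant labellings of iterated subdivisions *)

Section Barycenter.
Variables (R : realFieldType) (G : finType).
Local Notation point := {ffun G -> R}.
Implicit Types (x y : point) (t : seq point) (w : seq G) (d : R).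

Definition bary t : point := [ffun a => (\sum_(x <- t) x a) / (size t)%:R].

Definition simplex w : pred point := fun x =>
  [&& [forall a, 0 <= x a], \sum_a x a == 1 & [forall a, (x a != 0) ==> (a \in w)]].

Lemma simplexP w x : reflect
  [/\ forall a, 0 <= x a, \sum_a x a = 1 & forall a, a \notin w -> x a = 0] (simplex w x).
Proof.
apply: (iffP and3P) => [[/forallP x0 /eqP x1 /forallP xw]|[x0 x1 xw]]; split=> //.
- by move=> a aw; apply/eqP; apply: contraNT aw => xa; have /implyP := xw a; apply.
- exact/forallP.
- exact/eqP.
- by apply/forallP => a; apply/implyP; apply: contraNT => /xw ->.
Qed.

Definition vertex a : point := [ffun b => (b == a)%:R].

Lemma simplex_vertex w : all (simplex w) (map vertex w).
Proof.
apply/allP => _ /mapP[a aw ->]; apply/simplexP; split=> [b||b bw].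
- by rewrite ffunE ler0n.
- by rewrite (bigD1 a) //= ffunE eqxx big1 ?addr0 // => b /negbTE ba; rewrite ffunE ba.
- by rewrite ffunE; case: eqP => // ba; rewrite ba aw in bw.
Qed.

Lemma simplex_bary w t : (0 < size t)%N -> all (simplex w) t -> simplex w (bary t).
Proof.
move=> t0 /allP tw; have nt : (size t)%:R != 0 :> R by rewrite pnatr_eq0 -lt0n.
apply/simplexP; split=> [a||a aw].
- rewrite ffunE divr_ge0 ?ler0n // big_seq sumr_ge0 // => x /tw /simplexP[+ _ _]; exact.
- under eq_bigr do rewrite ffunE.
  rewrite -mulr_suml exchange_big /= big_seq.
  under eq_bigr => x xt do have /simplexP[_ -> _] := tw x xt.
  by rewrite -big_seq big_const_seq count_predT iter_addr_0 divff.
- rewrite ffunE big_seq big1 ?mul0r // => x /tw /simplexP[_ _]; exact.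
Qed.

Definition close d t := forall x y a, x \in t -> y \in t -> `|x a - y a| <= d.

Lemma bary_dist d t y a : (0 < size t)%N -> (forall x, x \in t -> `|x a - y a| <= d) ->
  `|bary t a - y a| <= d.
Proof.
move=> t0 ty; have nt : 0 < (size t)%:R :> R by rewrite ltr0n.
have -> : bary t a - y a = (\sum_(x <- t) (x a - y a)) / (size t)%:R.
  rewrite ffunE sumrB big_const_seq count_predT iter_addr_0 mulrBl -[y a *+ _]mulr_natr mulfK //.
  by rewrite gt_eqF.
rewrite normrM normfV [`|_%:R|]gtr0_norm // ler_pdivrMr //.
apply: (le_trans (ler_norm_sum _ _ _)); rewrite mulr_natr.
have -> : d *+ size t = \sum_(x <- t) d by rewrite big_const_seq count_predT iter_addr_0.
rewrite big_seq [leRHS]big_seq.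
by apply: ler_sum => x /ty.
Qed.

Lemma bary_close d t1 t2 t a : close d t -> (0 < size t1)%N -> (0 < size t2)%N ->
  {subset t1 <= t} -> {subset t2 <= t} -> `|bary t1 a - bary t2 a| <= d.
Proof.
move=> cl t10 t20 t1t t2t; apply: bary_dist => // x xt1.
by rewrite distrC; apply: bary_dist => // y yt2; rewrite distrC; apply: cl; [apply: t1t|apply: t2t].
Qed.

(* One of the differences averaged vanishes. *)
Lemma bary_contract d t x a : 0 <= d -> close d t -> x \in t ->
  `|bary t a - x a| <= (1 - (size t)%:R^-1) * d.
Proof.
move=> d0 cl xt; have nt : 0 < (size t)%:R :> R by rewrite ltr0n; case: (t) xt.
have -> : bary t a - x a = (\sum_(y <- t) (y a - x a)) / (size t)%:R.
  rewrite ffunE sumrB big_const_seq count_predT iter_addr_0 mulrBl -[x a *+ _]mulr_natr mulfK //.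
  by rewrite gt_eqF.
rewrite normrM normfV [`|_%:R|]gtr0_norm // ler_pdivrMr //.
have -> : (1 - (size t)%:R^-1) * d * (size t)%:R = d *+ (size t).-1.
  rewrite mulrAC mulrBl mul1r mulVf ?gt_eqF // -[RHS]mulr_natl; congr (_ * _).
  by rewrite -subn1 natrB ?ltr0n // -(ltr0n R).
apply: (le_trans (ler_norm_sum _ _ _)).
rewrite (perm_big _ (perm_to_rem xt)) big_cons /= subrr normr0 add0r -(size_rem xt).
have -> : d *+ size (rem x t) = \sum_(y <- rem x t) d.
  by rewrite big_const_seq count_predT iter_addr_0.
rewrite big_seq [leRHS]big_seq.
by apply: ler_sum => y /mem_rem yt; apply: cl.
Qed.

(** The position in a flag determines the number of vertices of the face, hence the player who
    labels it. *)
Lemma flag_nth (X Y : eqType) (beta : seq X -> Y) (t : seq X) l : flag beta t l ->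
  size l = size t /\ forall (y0 : Y) i, (i < size l)%N -> exists s : seq X,
    [/\ nth y0 l i = beta s, size s = (size t - i)%N & {subset s <= t}].
Proof.
elim=> [|s1 a s2 l' _ [IH1 IH2]]; first by split.
split=> [|y0 [|i] il]; first by rewrite /= IH1 !size_cat /= addnS.
  by exists (s1 ++ a :: s2); split; rewrite ?subn0.
have [s [nE sE ss]] := IH2 y0 i il; exists s; split=> //.
  by rewrite sE !size_cat /= addnS subSS.
by move=> x /ss; rewrite !mem_cat inE => /orP[->|->]; rewrite ?orbT.
Qed.

Lemma flag_bary_mem t l y : flag bary t l -> y \in l -> exists s,
  [/\ y = bary s, (0 < size s)%N & {subset s <= t}].
Proof.
move=> /flag_nth[lt nl] yl; have il : (index y l < size l)%N by rewrite index_mem.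
have [s [yE sE st]] := nl y _ il; exists s; split=> //.
  by rewrite -yE nth_index.
by rewrite sE subn_gt0 -lt.
Qed.

Lemma flag_simplex w t l : all (simplex w) t -> flag bary t l -> all (simplex w) l.
Proof.
move=> /allP tw fl; apply/allP => y /(flag_bary_mem fl)[s [-> s0 st]].
by apply: simplex_bary => //; apply/allP => x /st /tw.
Qed.

(** Induction treats two proper faces. The barycenter of [t] is compared with that of a smaller face
    by averaging [bary_contract] over the vertices of the latter. [N] keeps one factor for all
    faces. *)
Lemma flag_close d N t l : 0 <= d -> (size t <= N)%N -> close d t -> flag bary t l ->
  close ((1 - N%:R^-1) * d) l.
Proof.
move=> d0 + + fl; elim: {t} fl => // s1 a s2 {}l fl IH; set t := s1 ++ a :: s2 => tN clt.
have st : {subset s1 ++ s2 <= t}.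
  by move=> z; rewrite /t !mem_cat inE => /orP[->|->]; rewrite ?orbT.
have IHl : close ((1 - N%:R^-1) * d) l.
  apply: IH => [|x y b xs ys]; last by apply: clt; apply: st.
  by apply: leq_trans tN; rewrite /t !size_cat /= addnS.
have t0 : (0 < size t)%N by rewrite /t size_cat addnS.
have tl y b : y \in l -> `|bary t b - y b| <= (1 - N%:R^-1) * d.
  move=> /(flag_bary_mem fl)[s [-> s0 ss]]; rewrite distrC.
  apply: bary_dist => // x xs; rewrite distrC.
  apply: le_trans (bary_contract b d0 clt (st _ (ss _ xs))) _.
  apply: ler_wpM2r => //; rewrite lerB // lef_pV2 ?ler_nat ?posrE ?ltr0n //.
  exact: leq_trans tN.
have c0 : 0 <= (1 - N%:R^-1) * d.
  apply: mulr_ge0 => //; rewrite subr_ge0 invf_le1 ?ler1n ?ltr0n; exact: leq_trans tN.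
move=> x y b; rewrite !inE => /orP[/eqP->|xl] /orP[/eqP->|yl].
- by rewrite subrr normr0.
- exact: tl.
- by rewrite distrC; apply: tl.
- exact: IHl.
Qed.

End Barycenter.

(** * Iterated barycentric subdivision *)

Section IteratedSubdivision.
Variables (K : fieldType) (R : realFieldType) (G : finType).
Local Notation point := {ffun G -> R}.
Implicit Types (F : seq point -> K) (t : seq point).

Definition bsd m F := iter m (subdiv (@bary R G)) F.

Lemma bsdD m F1 F2 t : bsd m (fun s => F1 s + F2 s) t = bsd m F1 t + bsd m F2 t.
Proof.
rewrite /bsd; elim: m t => //= m IH t; rewrite -subdivD; congr subdiv.
by apply/funext => s; rewrite IH.
Qed.

Lemma bsdZ m k F t : bsd m (fun s => k * F s) t = k * bsd m F t.
Proof.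
rewrite /bsd; elim: m t => //= m IH t; rewrite -subdivZ; congr subdiv.
by apply/funext => s; rewrite IH.
Qed.

Lemma cobd_bsd m F : cobd (bsd m F) = bsd m (cobd F).
Proof.
rewrite /bsd; elim: m => //= m IH.
by apply/funext => t; rewrite cobd_subdiv IH.
Qed.

Lemma bsd_nil m F : bsd m F [::] = F [::].
Proof. by elim: m. Qed.

Lemma bsd_nat m (phi : point -> point) (P : pred point) F F' t :
  (forall s, (0 < size s)%N -> all P s -> P (bary s) /\ bary (map phi s) = phi (bary s)) ->
  (forall s, all P s -> F' (map phi s) = F s) ->
  all P t -> bsd m F' (map phi t) = bsd m F t.
Proof.
move=> hb hF; rewrite /bsd; elim: m t => [|m IH] t Pt /=; first exact: hF.
exact: (subdiv_nat hb IH).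
Qed.

Lemma bsd_neq0 m w F t d : 0 <= d -> all (simplex w) t -> close d t -> bsd m F t != 0 ->
  exists t', [/\ size t' = size t, all (simplex w) t',
    close ((1 - (size t)%:R^-1) ^+ m * d) t' & F t' != 0].
Proof.
move=> d0; rewrite /bsd => + + +; elim: m t F d d0 => [|m IH] t F d d0 tw tc /=.
  by exists t; rewrite mul1r.
move=> /subdiv_neq0[l fl Fl].
have [lt _] := flag_nth fl.
have c0 : 0 <= (1 - (size t)%:R^-1) * d.
  apply: mulr_ge0 => //; rewrite subr_ge0; case: (size t) => [|n]; first by rewrite invr0 ler01.
  by rewrite invf_le1 ?ler1n ?ltr0n.
have [t' [st' wt' ct' Ft']] := IH l F _ c0 (flag_simplex tw fl) (flag_close d0 (leqnn _) tc fl) Fl.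
exists t'; rewrite st' lt; split=> //.
by move: ct'; rewrite lt mulrA -exprSr.
Qed.

End IteratedSubdivision.

(** * Labels and the cochain map that they induce *)

Section Rainbow.
Variables (R : realFieldType) (G : finZmodType) (K : fieldType).
Local Notation point := {ffun G -> R}.
Implicit Types (x y : point) (t : seq point) (w : seq G).

(** Without the zero weights, a point of a face looks the same from every word having that face. *)
Definition support w x : seq (G * R) := [seq (a, x a) | a <- w & 0 < x a].

Definition shift_weights g (z : seq (G * R)) := [seq (az.1 + g, az.2) | az <- z].

Definition shift_point g x : point := [ffun a => x (a - g)].

Lemma support_shift g w x :
  support (translate g w) (shift_point g x) = shift_weights g (support w x).
Proof.
rewrite /support /shift_weights /translate filter_map -!map_comp.
have E a : shift_point g x (a + g) = x a by rewrite ffunE addrK.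
rewrite (eq_filter (a2 := fun a => 0 < x a)) => [|a /=]; last by rewrite E.
by apply: eq_map => a /=; rewrite E.
Qed.

Lemma support_neq0 w x : simplex w x -> support w x != [::].
Proof.
move=> /simplexP[x0 x1 xw].
have [a xa] : exists a, x a != 0.
  apply/existsP; apply: contraNT (oner_neq0 R) => /existsPn xa.
  by rewrite -x1 big1 // => a _; apply/eqP; have := xa a; rewrite negbK.
have : (a, x a) \in support w x.
  apply/mapP; exists a => //; rewrite mem_filter lt_neqAle eq_sym xa x0 /=.
  by apply: contraNT xa => /xw ->.
by case: (support w x).
Qed.

Lemma support_del s1 a s2 x : x a = 0 -> support (s1 ++ a :: s2) x = support (s1 ++ s2) x.
Proof. by move=> xa; rewrite /support !filter_cat /= xa ltxx. Qed.

Lemma bary_shift g t : bary (map (shift_point g) t) = shift_point g (bary t).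
Proof.
apply/ffunP => a; rewrite !ffunE size_map big_map; congr (_ / _).
by apply: eq_bigr => x _; rewrite ffunE.
Qed.

Lemma vertex_translate g w : map (@vertex R G) (translate g w) = map (shift_point g) (map (@vertex R G) w).
Proof.
rewrite /translate -!map_comp; apply: eq_map => a /=; apply/ffunP => b.
by rewrite !ffunE subr_eq.
Qed.

Variable lab : nat -> seq (G * R) -> G.
Hypothesis lab_shift : forall j g z, z != [::] -> lab j (shift_weights g z) = lab j z + g.

(* Player k chooses the label of a vertex coming from a simplex with k vertices. *)
Definition label w t : G := lab (size t) (support w (bary t)).

(** The word becomes the simplex on its unit vectors, subdivided [m] times; [subdiv (label w)] is
    one further subdivision, with labels in place of barycenters. *)
Definition pullback m (f : seq G -> K) w :=
  bsd m (subdiv (label w) f) (map (@vertex R G) w).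

(** Subdivision commutes with [cobd], but the labels depend on the word. On the face opposite to a
    deleted letter that coordinate is 0, so both words give the same labels. *)
Lemma cobd_pullback m f w : uniq w -> cobd (pullback m f) w = pullback m (cobd f) w.
Proof.
move=> uw; rewrite /pullback.
have -> : subdiv (label w) (cobd f) = cobd (subdiv (label w) f).
  by apply/funext => t; rewrite cobd_subdiv.
rewrite -cobd_bsd cobd_map; apply: cobd_ext => s1 a s2 wE.
set s := s1 ++ s2.
have as_ : a \notin s by move: uw; rewrite wE -cat1s uniq_catCA /= => /andP[].
have := @bsd_nat K R G m id (simplex s) (subdiv (label s) f) (subdiv (label w) f)
  (map (@vertex R G) s) _ _ (simplex_vertex R s); rewrite map_id => -> //.
  by move=> t t0 ts; split; [exact: simplex_bary|rewrite map_id].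
move=> t ts; have := @subdiv_nat K _ _ _ _ (label s) (label w) id (simplex s) f f id predT t.
rewrite map_id; apply => // [v v0 vs|v _]; last by rewrite map_id.
rewrite map_id; split=> //; rewrite /label wE support_del //.
by have /simplexP[_ _] := simplex_bary v0 vs; apply.
Qed.

Lemma pullback_translate m f g w :
  pullback m (fun s => f (translate g s)) w = pullback m f (translate g w).
Proof.
rewrite /pullback vertex_translate; apply/esym.
apply: (@bsd_nat _ _ _ _ _ (simplex w)); last exact: simplex_vertex.
  by move=> t t0 tw; split; [exact: simplex_bary|rewrite bary_shift].
move=> t tw; apply: (@subdiv_nat _ _ _ _ _ _ _ _ (simplex w) _ _ (fun a => a + g) predT) => //.
move=> s s0 sw; split=> //; rewrite /label size_map bary_shift support_shift lab_shift //.
exact/support_neq0/simplex_bary.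
Qed.

(** A nonzero value selects a small simplex and a flag of its faces on whose labels [f] is nonzero;
    as [f] is alternating, these labels are distinct. *)
Lemma pullback_neq0 m n f w : size w = n -> alternating n f -> pullback m f w != 0 ->
  exists x : 'I_n -> point,
    [/\ forall i, simplex w (x i),
        forall i j a, `|x i a - x j a| <= (1 - n%:R^-1) ^+ m &
        injective (fun i : 'I_n => lab i.+1 (support w (x i)))].
Proof.
move=> wn af Pf.
have vc : close 1 (map (@vertex R G) w).
  move=> _ _ a /mapP[b _ ->] /mapP[c _ ->]; rewrite !ffunE.
  by case: (a == b); case: (a == c); rewrite ?subrr ?subr0 ?sub0r ?normrN ?normr0 ?normr1 ?ler01.
have [t [st tw]] := bsd_neq0 ler01 (simplex_vertex R w) vc Pf.
rewrite size_map wn mulr1 in st * => ct /subdiv_neq0[l fl fl0].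
have [lt nl] := flag_nth fl.
have ul : uniq l by apply: contraNT fl0 => nul; rewrite (alternating_nuniq af nul).
(* Flags start with the largest face, so the face with [i.+1] vertices has position [n - i.+1]. *)
have /choice[s hs] : forall i : 'I_n, exists s : seq point,
    [/\ nth 0 l (n - i.+1) = label w s, size s = i.+1 & {subset s <= t}].
  move=> i; have [|s [ns ss sst]] := nl 0 (n - i.+1)%N; first by rewrite lt st; have := ltn_ord i; lia.
  by exists s; split=> //; rewrite ss st; have := ltn_ord i; lia.
have s0 i : (0 < size (s i))%N by have [_ -> _] := hs i.
exists (fun i => bary (s i)); split=> [i|i j a|i j].
- have [_ _ sst] := hs i; apply: simplex_bary => //; apply/allP => x /sst xt.
  exact: (allP tw).
- have [_ _ si] := hs i; have [_ _ sj] := hs j.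
  exact: bary_close ct _ _ si sj.
- have [ni si _] := hs i; have [nj sj _] := hs j.
  rewrite -{1}si -{1}sj -/(label w (s i)) -/(label w (s j)) -ni -nj => /eqP.
  rewrite nth_uniq ?lt ?st //; [|have := ltn_ord i; lia|have := ltn_ord j; lia].
  move=> /eqP ij; apply/val_inj => /=; have := ltn_ord i; have := ltn_ord j; lia.
Qed.

End Rainbow.

(** * Configurations *)

Local Open Scope classical_set_scope.

Section WeightedWords.
Variables (R : realType) (G : finZmodType) (Pi : finType) (r : nat) (pl : G -> Pi).
Hypotheses (pl_inj : injective pl) (cG : #|G| = r).
Local Notation config := (config R r Pi).
Implicit Types (c : config) (z : seq (G * R)) (w : seq G) (x : {ffun G -> R}).

Definition weight z : R := \sum_(az <- z) az.2.

Definition weighted_word z :=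
  [&& uniq (map fst z), all (fun az => 0 < az.2) z & weight z == 1].

(* z lists the labels and the lengths of the tiles of c, from left to right. *)
Definition encodes c z := [/\ tiles c = size z,
  forall i : 'I_(tiles c).+1, Defs.cut c i = weight (take i z) &
  forall i : 'I_(tiles c), plate c i = pl (nth (0, 0) z i).1].

Lemma encodes_ex z : weighted_word z -> exists c, encodes c z.
Proof.
move=> /and3P[uz pz /eqP wz].
have zr : (size z <= r)%N by rewrite -cG -(size_map fst) -(card_uniqP uz) max_card.
have c0 : (fun i : 'I_(size z).+1 => weight (take i z)) ord0 = 0.
  by rewrite take0 /weight big_nil.
have c1 : (fun i : 'I_(size z).+1 => weight (take i z)) ord_max = 1.
  by rewrite take_size.
have clt (i j : 'I_(size z).+1) : (i < j)%N -> weight (take i z) < weight (take j z).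
  move=> ij; have -> : take j z = take i z ++ take (j - i) (drop i z).
    by rewrite -takeD subnKC // ltnW.
  rewrite /weight big_cat /= ltrDl; case E : (take _ _) => [|az s].
    have := congr1 size E; rewrite size_take size_drop /=; have := ltn_ord j.
    by case: ifP; lia.
  have /allP pos : all (fun az => 0 < az.2) (az :: s).
    by rewrite -E; apply/allP => b /mem_take /mem_drop; apply: (allP pz).
  rewrite big_cons ltr_pwDl //; first by apply: pos; rewrite mem_head.
  by rewrite big_seq; apply: sumr_ge0 => b bs; apply/ltW/pos; rewrite inE bs orbT.
have pinj : injective (fun i : 'I_(size z) => pl (nth (0, 0) z i).1).
  move=> i j /pl_inj; rewrite -!(nth_map _ 0) // => /eqP.
  by rewrite nth_uniq ?size_map // => /eqP /val_inj.
by exists (Config zr c0 c1 clt pinj).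
Qed.

Lemma encodes_inj z c c' : encodes c z -> encodes c' z -> c = c'.
Proof.
case: c c' => [k kr x x0 x1 xl a ai] [k' kr' x' x0' x1' xl' a' ai'] [/= e hx ha] [/= e' hx' ha'].
subst k k'.
have xx : x = x' by apply/funext => i; rewrite hx hx'.
have aa : a = a' by apply/funext => i; rewrite ha ha'.
by subst x' a'; rewrite (Prop_irrelevance kr kr') (Prop_irrelevance x0 x0') (Prop_irrelevance x1 x1') (Prop_irrelevance xl xl') (Prop_irrelevance ai ai').
Qed.

Section Action.
Variables (gT : finGroupType) (to : {action gT &-> Pi}).

Lemma encodes_act s g z c : (forall a, pl (a + g) = to (pl a) s) ->
  encodes c z -> encodes (config_act to c s) (shift_weights g z).
Proof.
move=> plD [tz cz pz]; split; first by rewrite size_map.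
  by move=> i; rewrite /= cz /weight -map_take big_map.
move=> i /=; rewrite pz -plD (nth_map (0, 0)) //=.
by rewrite -tz.
Qed.

End Action.

Section Support.
Variable w : seq G.
Variable x : {ffun G -> R}.
Hypothesis x0 : forall a, 0 <= x a.

Lemma weight_support v : weight (support v x) = \sum_(a <- v) x a.
Proof.
rewrite /weight /support big_map big_filter [RHS](bigID (fun a => 0 < x a)) /=.
rewrite [X in _ = _ + X]big1 ?addr0 // => a.
by rewrite lt_neqAle x0 andbT eq_sym negbK => /eqP.
Qed.

Lemma support_cat v1 v2 : support (v1 ++ v2) x = support v1 x ++ support v2 x.
Proof. by rewrite /support filter_cat map_cat. Qed.

Lemma support_take i : exists v1 v2, w = v1 ++ v2 /\ take i (support w x) = support v1 x.
Proof.
elim: w i => [|a v IH] i; first by exists [::], [::].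
case: i => [|i]; first by exists [::], (a :: v); rewrite take0.
rewrite /support /=; case: ifP => xa /=.
  by have [v1 [v2 [-> h]]] := IH i; exists (a :: v1), v2; rewrite /= xa /= h.
by have [v1 [v2 [-> h]]] := IH i.+1; exists (a :: v1), v2; rewrite /= xa.
Qed.

Lemma support_nth i : (i < size (support w x))%N -> exists v1 a v2,
  [/\ w = v1 ++ a :: v2, 0 < x a & i = size (support v1 x)].
Proof.
elim: w i => [|a v IH] i //.
rewrite {1}/support /=; case: ifP => xa; last first.
  by move=> /IH[v1 [b [v2 [-> xb iE]]]]; exists (a :: v1), b, v2; rewrite /support /= xa.
case: i => [|i]; first by exists [::], a, v.
move=> /= /IH[v1 [b [v2 [-> xb ->]]]]; exists (a :: v1), b, v2.
by rewrite /support /= xa.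
Qed.

Variable c : config.
Hypothesis cx : encodes c (support w x).

(** Prefixes of [w], rather than of its support, allow comparing the cuts of points with different
    supports. *)
Lemma encodes_cutset t : cutset c t <->
  exists v1 v2, w = v1 ++ v2 /\ t = \sum_(a <- v1) x a.
Proof.
have [tc cc _] := cx; split=> [[i _ <-]|[v1 [v2 [wE ->]]]].
  have [v1 [v2 [wE h]]] := support_take i.
  by exists v1, v2; rewrite cc h weight_support.
have iw : (size (support v1 x) < (tiles c).+1)%N.
  by rewrite tc wE support_cat size_cat ltnS leq_addr.
exists (Ordinal iw) => //; rewrite cc /= wE support_cat take_size_cat //.
exact: weight_support.
Qed.

Lemma encodes_tile v1 a v2 : w = v1 ++ a :: v2 -> 0 < x a ->
  exists i : 'I_(tiles c), [/\ i = size (support v1 x) :> nat, tile_left i = \sum_(b <- v1) x b,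
    tile_right i = \sum_(b <- v1) x b + x a & plate c i = pl a].
Proof.
have [tc cc pc] := cx => wE xa.
have sE : support w x = support v1 x ++ (a, x a) :: support v2 x.
  by rewrite wE support_cat /support /= xa.
have iw : (size (support v1 x) < tiles c)%N by rewrite tc sE size_cat /= addnS ltnS leq_addr.
exists (Ordinal iw); split=> //.
- by rewrite /tile_left cc /= sE take_size_cat // weight_support.
- rewrite /tile_right cc /= /bump leq0n add1n sE.
  by rewrite -cat_rcons take_size_cat ?size_rcons // /weight -cats1 big_cat big_seq1 /= -/(weight _) weight_support.
- by rewrite pc /= sE nth_cat ltnn subnn.
Qed.

Lemma encodes_tileP (i : 'I_(tiles c)) : exists v1 a v2,
  [/\ w = v1 ++ a :: v2, 0 < x a, tile_left i = \sum_(b <- v1) x b,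
    tile_right i = \sum_(b <- v1) x b + x a & plate c i = pl a].
Proof.
have [tc _ _] := cx.
have /support_nth[v1 [a [v2 [wE xa iE]]]] : (i < size (support w x))%N by rewrite -tc.
have [j [jE lj rj pj]] := encodes_tile wE xa.
have -> : i = j by apply/val_inj; rewrite /= iE jE.
by exists v1, a, v2.
Qed.

End Support.
End WeightedWords.

(** * Limits of configurations and compactness of simplices *)

Section Limits.
Variables (R : realType) (G : finZmodType) (Pi : finType) (r : nat) (pl : G -> Pi).
Local Notation config := (config R r Pi).
Local Notation point := {ffun G -> R}.
Implicit Types (c d : config) (w : seq G) (x y : point).

Lemma hausdorff_dist_ge0 c d : 0 <= hausdorff_dist (cutset c) (cutset d).
Proof.
rewrite /hausdorff_dist le_max; apply/orP; left.
have [a ca] := cutset_neq0 c; apply: (@le_trans _ _ (set_dist a (cutset d))).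
  apply: lb_le_inf => [|_ [b _ <-] //].
  by have [b db] := cutset_neq0 d; exists `|a - b|; exists b.
apply: ub_le_sup; last by exists a.
by exists 1 => _ [b /cutset01 cb <-]; exact: set_dist_le1.
Qed.

Definition l1_dist x y := \sum_a `|x a - y a|.

Lemma l1_dist_coord x y a : `|x a - y a| <= l1_dist x y.
Proof. by rewrite /l1_dist (bigD1 a) //= lerDl sumr_ge0. Qed.

Lemma l1_dist_sum x y v : uniq v -> `|\sum_(a <- v) x a - \sum_(a <- v) y a| <= l1_dist x y.
Proof.
move=> uv; rewrite -sumrB; apply: le_trans (ler_norm_sum _ _ _) _.
by rewrite big_uniq //= /l1_dist [leRHS](bigID [in v]) /= lerDl sumr_ge0.
Qed.

Lemma near_l1_dist (X : nat -> point) x (e : R) : 0 < e ->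
  (forall a, X n a @[n --> \oo] --> x a) -> \forall n \near \oo, l1_dist (X n) x < e.
Proof.
move=> e0 Xx; pose d := e / (#|G|.+1)%:R.
have d0 : 0 < d by rewrite divr_gt0 ?ltr0n.
have : \forall n \near \oo, forall a, `|x a - X n a| < d.
  by apply: filter_forall => a; move/cvgrPdist_lt: (Xx a); apply.
apply: filterS => n hn; apply: (@le_lt_trans _ _ (\sum_(a : G) d)).
  by apply: ler_sum => a _; rewrite distrC ltW.
rewrite sumr_const -mulr_natr /d mulrAC ltr_pdivrMr ?ltr0n // ltr_pM2l //.
by rewrite ltr_nat.
Qed.

(** Sums over a common prefix of [w] differ by at most the l1 distance, which bounds the Hausdorff
    distance. A letter of positive weight in the limit eventually has a tile around the limit
    midpoint. *)
Lemma encodes_cvg w (X : nat -> point) x (u : nat -> config) c : uniq w ->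
  (forall n, simplex w (X n)) -> simplex w x ->
  (forall a, X n a @[n --> \oo] --> x a) ->
  (forall n, encodes pl (u n) (support w (X n))) -> encodes pl c (support w x) ->
  config_cvg u c.
Proof.
move=> uw Xw xw Xx eu ec.
have X0 n a : 0 <= X n a by have /simplexP[+ _ _] := Xw n; apply.
have x0 a : 0 <= x a by have /simplexP[+ _ _] := xw; apply.
have pre v1 v2 n : w = v1 ++ v2 ->
    `|\sum_(a <- v1) X n a - \sum_(a <- v1) x a| <= l1_dist (X n) x.
  by move=> wE; apply: l1_dist_sum; move: uw; rewrite wE cat_uniq => /andP[].
split.
  apply/cvgrPdist_le => e e0; apply: filterS (near_l1_dist e0 Xx) => n hn.
  rewrite sub0r normrN ger0_norm ?hausdorff_dist_ge0 //.
  apply: hausdorff_near_le; split=> a.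
    move=> /(encodes_cutset (X0 n) (eu n))[v1 [v2 [wE ->]]].
    exists (\sum_(b <- v1) x b); first by apply/(encodes_cutset x0 ec); exists v1, v2.
    exact: le_lt_trans (pre _ _ n wE) hn.
  move=> /(encodes_cutset x0 ec)[v1 [v2 [wE ->]]].
  exists (\sum_(b <- v1) X n b); first by apply/(encodes_cutset (X0 n) (eu n)); exists v1, v2.
  by rewrite distrC; apply: le_lt_trans (pre _ _ n wE) hn.
apply: filter_forall => i.
have [v1 [a [v2 [wE xa li ri pi]]]] := encodes_tileP x0 ec i.
(* The left end moves by less than [x a / 4] and the right end by less than twice that, while the
   midpoint is at distance [x a / 2] from both. *)
have e0 : 0 < x a / 4 by rewrite divr_gt0.
apply: filterS (near_l1_dist e0 Xx) => n hn.
have Da := le_lt_trans (l1_dist_coord (X n) x a) hn.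
have Dv := le_lt_trans (pre _ _ n wE) hn.
have Xa : 0 < X n a by move: Da; rewrite ltr_norml; lra.
have [j [_ lj rj pj]] := encodes_tile (X0 n) (eu n) wE Xa.
exists j; last by rewrite pj pi.
rewrite /tile /tile_mid /= lj rj li ri.
by move: Da Dv; rewrite !ltr_norml => /andP[? ?] /andP[? ?]; apply/andP; split; lra.
Qed.

(** Coordinates are treated one at a time; those already convergent stay so along a further
    subsequence. *)
Lemma point_subsequence (X : nat -> point) (s : seq G) : (forall n a, `|X n a| <= 1) ->
  exists f : nat -> nat, (forall n, (n <= f n)%N) /\
    forall a, a \in s -> cvgn (fun n => X (f n) a).
Proof.
move=> X1; elim: s => [|a s [f [fn fs]]]; first by exists id.
have [|g gi ga] := @bolzano_weierstrass R (fun n => X (f n) a).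
  by exists 1; split=> // M M1 n _ /=; apply: le_trans (X1 _ _) (ltW M1).
have gn n : (n <= g n)%N.
  elim: n => // n IH; apply: leq_ltn_trans IH _; rewrite ltnNge; apply/negP => h.
  by have := gi n.+1 n; rewrite !leEnat h ltnn.
have g_oo : g n @[n --> \oo] --> \oo.
  by apply/cvgnyPge => k; exists k => // n /= kn; apply: leq_trans (gn n).
exists (f \o g); split=> [n /=|b]; first exact: leq_trans (gn n) (fn _).
rewrite inE => /orP[/eqP-> //|/fs /cvg_ex[l fl]].
by apply/cvg_ex; exists l; apply: (cvg_comp _ _ g_oo fl).
Qed.

Lemma simplex_lim w (X : nat -> point) x : (forall n, simplex w (X n)) ->
  (forall a, X n a @[n --> \oo] --> x a) -> simplex w x.
Proof.
move=> Xw Xx.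
have appr e : 0 < e -> exists y, simplex w y /\ l1_dist y x < e.
  by move=> e0; have [n hn] := filter_ex (near_l1_dist e0 Xx); exists (X n).
apply/simplexP; split=> [a||a aw].
- apply/ler_addgt0Pr => e /appr[y [/simplexP[/(_ a) y0 _ _] yx]].
  by have := le_lt_trans (l1_dist_coord y x a) yx; rewrite ltr_norml; lra.
- apply/eqP; rewrite eq_sym -subr_eq0 -normr_le0; apply/ler_addgt0Pr => e /appr[y [/simplexP[_ <- _] yx]].
  rewrite add0r; apply/ltW/(le_lt_trans _ yx)/le_trans/(l1_dist_sum y x (index_enum_uniq G)).
  exact: lexx.
- apply/eqP; rewrite -normr_le0; apply/ler_addgt0Pr => e /appr[y [/simplexP[_ _ /(_ a aw) ya] yx]].
  by have := le_lt_trans (l1_dist_coord y x a) yx; rewrite ya sub0r normrN add0r => /ltW.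
Qed.

Lemma simplex_norm w x a : simplex w x -> `|x a| <= 1.
Proof.
move=> /simplexP[x0 <- _]; rewrite ger0_norm // (bigD1 a) //= lerDl.
exact: sumr_ge0.
Qed.

Lemma simplex_subsequence w (X : nat -> point) : (forall n, simplex w (X n)) ->
  exists (f : nat -> nat) x, [/\ forall n, (n <= f n)%N, simplex w x &
    forall a, X (f n) a @[n --> \oo] --> x a].
Proof.
move=> Xw; have [|f [fn fc]] := @point_subsequence X (enum G).
  by move=> n a; apply: simplex_norm (Xw n).
pose x : point := [ffun a => limn (fun n => X (f n) a)].
have fx a : X (f n) a @[n --> \oo] --> x a by rewrite ffunE; apply: fc; rewrite mem_enum.
by exists f, x; split=> //; apply: simplex_lim fx => n; apply: Xw.
Qed.

End Limits.

(** * From rainbow simplices to an envy-free division *)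

Section EnvyFree.
Variables (R : realType) (p nu r : nat).
Hypotheses (pp : prime p).
Local Notation G := 'rV['F_p]_nu.
Hypothesis cG : #|{: G}| = r.
Variables (Pi : finType) (pl : G -> Pi).
Hypotheses (pl_bij : bijective pl).
Variable to : {action G &-> Pi}.
Hypothesis pl_act : forall a s, pl (a + s) = to (pl a) s.
Local Notation config := (config R r Pi).
Variable A : 'I_r -> Pi -> set config.
Hypotheses (hclosed : forall j i, closed (A j i))
  (hcover : forall j c, exists i, A j i c)
  (hequiv : forall s i j c, A j i c <-> A j (to i s) (config_act to c s)).
Local Notation point := {ffun G -> R}.
Implicit Types (w : seq G) (x : point) (z : seq (G * R)).

Let pl_inj := bij_inj pl_bij.

Lemma shift_weightsD g h z : shift_weights g (shift_weights h z) = shift_weights (h + g) z.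
Proof. by rewrite /shift_weights -map_comp; apply: eq_map => az /=; rewrite addrA. Qed.

Lemma shift_weights0 z : shift_weights 0 z = z.
Proof. by rewrite /shift_weights -[RHS]map_id; apply: eq_map => -[a t] /=; rewrite addr0. Qed.

Lemma weighted_word_shift g z : weighted_word (shift_weights g z) = weighted_word z.
Proof.
rewrite /weighted_word /shift_weights -map_comp (map_comp (fun a => a + g) fst).
by rewrite (map_inj_uniq (addIr g)) all_map /weight big_map.
Qed.

Lemma weighted_word_support w x : uniq w -> simplex w x -> weighted_word (support w x).
Proof.
move=> uw /simplexP[x0 x1 xw]; apply/and3P; split.
- by rewrite /support -map_comp map_id filter_uniq.
- by apply/allP => _ /mapP[a + ->] /=; rewrite mem_filter => /andP[].
- rewrite weight_support // -x1 big_uniq //= [eqbRHS](bigID [in w]) /= [X in _ == _ + X]big1 ?addr0 //.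
Qed.

(** Each word is translated so that its first letter is 0, a preferred plate is chosen for the
    result, and the choice is translated back. Equivariance of the preferences makes it valid for
    the original word. *)
Lemma labelling_ex : exists lab : nat -> seq (G * R) -> G,
  (forall j g z, z != [::] -> lab j (shift_weights g z) = lab j z + g) /\
  (forall (i : 'I_r) z c, weighted_word z -> encodes pl c z -> A i (pl (lab i.+1 z)) c).
Proof.
have /choice[lab0 hlab0] : forall jz : nat * seq (G * R), exists g,
    weighted_word jz.2 -> forall (hj : (jz.1 < r)%N) c, encodes pl c jz.2 ->
    A (Ordinal hj) (pl g) c.
  move=> [j z] /=; have [wz|wz] := boolP (weighted_word z); last by exists 0.
  have [jr|jr] : (j < r)%N \/ (r <= j)%N by case: (ltnP j r); [left|right].
  2: by exists 0 => _ hj; have := leq_trans hj jr; rewrite ltnn.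
  have [c ec] := encodes_ex pl_inj cG wz.
  have [i Ai] := hcover (Ordinal jr) c; have [ip _ ipK] := pl_bij.
  exists (ip i) => _ hj c' ec'; rewrite ipK -(encodes_inj ec ec').
  by rewrite (_ : Ordinal hj = Ordinal jr) //; apply: val_inj.
(* Players are numbered from 0 and faces have at least one vertex, whence [j.-1]. *)
pose lab j z := let a := (head (0, 0) z).1 in lab0 (j.-1, shift_weights (- a) z) + a.
exists lab; split=> [j g [//|[a t] z] _|[i hi] z c wz ec].
  rewrite /lab [(head _ _).1]/= [(head _ (_ :: _)).1]/= shift_weightsD addrA.
  by rewrite opprD [- a - g]addrC addrA subrr sub0r.
rewrite /lab /=; set a := (head _ _).1; set g := lab0 _.
have ec1 : encodes pl (config_act to c (- a)) (shift_weights (- a) z).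
  by apply: encodes_act ec => b; apply: pl_act.
rewrite pl_act; have /= Ag := hlab0 (i, shift_weights (- a) z) _ hi _ ec1.
have {Ag} /(hequiv a) : A (Ordinal hi) (pl g) (config_act to c (- a)).
  by apply: Ag; rewrite weighted_word_shift.
have ec2 : encodes pl (config_act to (config_act to c (- a)) a) z.
  rewrite -[z in encodes _ _ z]shift_weights0 -(addNr a) -shift_weightsD.
  by apply: encodes_act ec1 => b; apply: pl_act.
by rewrite (encodes_inj ec2 ec).
Qed.

Definition rainbow (lab : nat -> seq (G * R) -> G) (w : seq G) (s : 'I_r -> G) (e : R) :=
  [/\ uniq w, injective s & exists x : 'I_r -> point,
    [/\ forall i, simplex w (x i), forall i j a, `|x i a - x j a| <= e &
        forall i : 'I_r, lab i.+1 (support w (x i)) = s i]].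

Lemma rainbow_ex lab (e : R) : 0 < e ->
  (forall j g z, z != [::] -> lab j (shift_weights g z) = lab j z + g) ->
  exists (w : r.-tuple G) (s : {ffun 'I_r -> G}), rainbow lab w s e.
Proof.
move=> e0 labS.
have r0 : (0 < r)%N by rewrite -cG; apply/card_gt0P; exists 0.
have [m hm] : exists m, (1 - r%:R^-1 : R) ^+ m <= e.
  have q1 : `|1 - r%:R^-1 : R| < 1.
    have r1 : 0 < (r%:R^-1 : R) <= 1 by rewrite invr_gt0 ltr0n r0 invf_le1 ?ler1n ?ltr0n.
    by rewrite ltr_norml; lra.
  have /cvgrPdist_le /(_ e e0) hh := cvg_expr q1.
  have [m] := filter_ex hh; rewrite sub0r normrN => hm; exists m.
  exact: le_trans (ler_norm _) hm.
have [|||||f [w [af hw Pf]]] := @elementary_abelian_obstruction p nu pp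
  (@pullback R _ (ratfrac p) lab m).
- by move=> f; rewrite /pullback bsd_nil.
- move=> f h w; rewrite /pullback -bsdD; congr bsd.
  by apply/funext => t; rewrite subdivD.
- move=> k f w; rewrite /pullback -bsdZ; congr bsd.
  by apply/funext => t; rewrite subdivZ.
- by move=> f w uw; apply: cobd_pullback.
- by move=> f g w uw; apply: pullback_translate.
have /and3P[uw _ /eqP sw] := hw; rewrite cG in af sw.
have [x [xw xe xl]] := pullback_neq0 sw af Pf.
exists (tcast sw (in_tuple w)), [ffun i : 'I_r => lab i.+1 (support w (x i))].
rewrite val_tcast /=; split=> // [i j|]; first by rewrite !ffunE => /xl.
exists x; split=> // [i j a|i]; first exact: le_trans (xe _ _ _) hm.
by rewrite ffunE.
Qed.

(** There are finitely many pairs [(w, s)]. If each failed for some bound, [rainbow_ex] at the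
    smallest of these bounds would be contradicted. *)
Lemma rainbow_uniform lab :
  (forall j g z, z != [::] -> lab j (shift_weights g z) = lab j z + g) ->
  exists w s, forall e : R, 0 < e -> rainbow lab w s e.
Proof.
move=> labS; apply: contrapT => no.
have /choice[d hd] : forall ws : r.-tuple G * {ffun 'I_r -> G}, exists e : R,
    0 < e /\ ~ rainbow lab ws.1 ws.2 e.
  move=> [w s]; apply: contrapT => no'; apply: no; exists w, s => e e0.
  by apply: contrapT => nr; apply: no'; exists e.
have d0 : 0 < \big[Num.min/1]_ws d ws.
  by apply/bigmin_gtP; split=> // ws _; have [] := hd ws.
have [w [s [uw is_ [x [xw xe xl]]]]] := rainbow_ex d0 labS.
have [_] := hd (w, s); apply; split=> //; exists x; split=> // i j a.
apply: le_trans (xe i j a) _; exact: bigmin_le.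
Qed.

Lemma envy_free_division : exists (c : config) (s : 'I_r -> Pi),
  bijective s /\ forall j, A j (s j) c.
Proof.
have [lab [labS labA]] := labelling_ex.
have [w [s ws]] := rainbow_uniform labS.
have r0 : (0 < r)%N by rewrite -cG; apply/card_gt0P; exists 0.
pose j0 := Ordinal r0.
have [uw is_ _] := ws 1 ltr01.
have /choice[x hx] : forall n : nat, exists x : 'I_r -> point,
    [/\ forall i, simplex w (x i), forall i j a, `|x i a - x j a| <= n.+1%:R^-1 &
        forall i : 'I_r, lab i.+1 (support w (x i)) = s i].
  by move=> n; have [|_ _] := ws n.+1%:R^-1; first by rewrite invr_gt0 ltr0n.
have [|f [y [fn yw fy]]] := @simplex_subsequence R _ w (fun n => x n j0).
  by move=> n; have [] := hx n.
(* Only the points of player [j0] were made convergent; those of the others have the same limit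
   because the mutual distances tend to 0. *)
have fyi i a : x (f n) i a @[n --> \oo] --> y a.
  have hh : (fun n => x (f n) i a - x (f n) j0 a) n @[n --> \oo] --> (0 : R).
    apply: norm_cvg0; apply: (@squeeze_cvgr _ _ _ _ (cst 0) (@harmonic R)).
    - apply: nearW => n /=; rewrite normr_ge0 /=; have [_ xe _] := hx (f n).
      by apply: le_trans (xe i j0 a) _; rewrite /harmonic lef_pV2 ?posrE ?ltr0n // ler_nat ltnS.
    - exact: cvg_cst.
    - exact: cvg_harmonic.
  have -> : (fun n => x (f n) i a) = (fun n => (x (f n) i a - x (f n) j0 a) + x (f n) j0 a).
    by apply/funext => n; rewrite subrK.
  by rewrite -[y a]add0r; apply: cvgD hh (fy a).
have [c ec] := encodes_ex pl_inj cG (weighted_word_support uw yw).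
exists c, (pl \o s); split.
  apply: inj_card_bij; first exact: inj_comp.
  by rewrite card_ord -(bij_eq_card pl_bij) cG.
move=> i; have xw n : simplex w (x (f n) i) by have [] := hx (f n).
have /choice[u hu] : forall n : nat, exists c : config, encodes pl c (support w (x (f n) i)).
  by move=> n; apply: (encodes_ex pl_inj cG); apply: weighted_word_support.
have /config_closedP/(_ u c) := @hclosed i (pl (s i)); apply=> [n|].
  have [_ _ <-] := hx (f n); apply: labA (hu n).
  exact: weighted_word_support.
by apply: (encodes_cvg uw xw yw _ hu ec) => a; apply: fyi.
Qed.
End EnvyFree.

Theorem theorem3p1 (R : realType) (p nu r : nat)
    (hp : prime p) (hnu : (0 < nu)%N) (hr : r = (p ^ nu)%N)
    (Pi : finType) (hPi : #|Pi| = r)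
    (to : {action 'rV['Z_p]_nu &-> Pi})
    (hfree : forall (s : 'rV['Z_p]_nu) (i : Pi), to i s = i -> s = 1%g)
    (htrans : [transitive [set: 'rV['Z_p]_nu]%SET, on [set: Pi]%SET | to])
    (A : 'I_r -> Pi -> set (config R r Pi))
    (hclosed : forall (j : 'I_r) (i : Pi), closed (A j i))
    (hcover : forall j : 'I_r, (\bigcup_(i in [set: Pi]) A j i = [set: config R r Pi])%classic)
    (hequiv : forall (s : 'rV['Z_p]_nu) (i : Pi) (j : 'I_r) (c : config R r Pi),
        A j i c <-> A j (to i s) (config_act to c s)) :
  exists (c : config R r Pi) (s : 'I_r -> Pi),
    bijective s /\ (\bigcap_(j in [set: 'I_r]) A j (s j))%classic c.
Proof.
(* The proof needs the field 'F_p, that is 'Z_(pdiv p), instead of 'Z_p. *)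
have main q : q = pdiv p -> forall to : {action 'rV['Z_q]_nu &-> Pi},
    (forall s i, to i s = i -> s = 1%g) ->
    (forall s i j c, A j i c <-> A j (to i s) (config_act to c s)) ->
    exists (c : config R r Pi) (s : 'I_r -> Pi),
      bijective s /\ (\bigcap_(j in [set: 'I_r]) A j (s j))%classic c.
  move=> -> {htrans} {}to {}hfree {}hequiv.
  have /card_gt0P[i0 _] : (0 < #|Pi|)%N by rewrite hPi hr expn_gt0 prime_gt0.
  (* The orbit map identifies [G] with the plates: freeness makes it injective, and both sides have
     [r] elements. *)
  pose pl (g : 'rV['F_p]_nu) := to i0 g.
  have pl_inj : injective pl.
    move=> g h gh; apply/eqP; rewrite eq_mulgV1; apply/eqP/(hfree _ i0).
    by rewrite actM [to i0 g]gh actK.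
  have cG : #|{: 'rV['F_p]_nu}| = r by rewrite card_mx mul1n card_Fp.
  have pl_bij : bijective pl by apply: inj_card_bij; rewrite // hPi cG.
  have [|j c||c [s [sb sA]]] := @envy_free_division R p nu r hp cG Pi pl pl_bij to _ A hclosed.
  - by move=> a s; rewrite /pl -actM.
  - have : (\bigcup_(i in [set: Pi]) A j i)%classic c by rewrite hcover.
    by move=> [i _ Ai]; exists i.
  - by move=> s i j c; apply: hequiv.
  by exists c, s; split=> // j _; apply: sA.
exact: (main p (esym (pdiv_id hp)) to).
Qed.
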